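(* Let $d \geq 2$ be an integer, $\mu$ a probability measure on $\mathbb{Z}^d$ and $A \in \mathrm{GL}_d(\mathbb{Z})$ a hyperbolic matrix. Let $(B_t)_{t\ge 1}$ be i.i.d. random variables with law $\mu$, and for each integer $n \ge 1$ let $(X_t)_{t \ge 0}$ be the random walk on $(\mathbb{Z}/n\mathbb{Z})^d$ defined by $X_0 = 0$ and $X_t = A X_{t-1} + B_t \bmod n$ for $t \ge 1$. Let $P^t(0,\cdot)$ be the law of $X_t$ and $U$ the uniform measure on $(\mathbb{Z}/n\mathbb{Z})^d$ (both depend on $n$). Let $H$ be the smallest $A$-invariant subgroup of $\mathbb{Z}^d$ that contains $\operatorname{supp}\mu - \operatorname{supp}\mu$. Suppose that $H$ has rank $d$ and is generated by $(a_i u_i)_{i=1}^d$ for some basis $(u_i)_{i=1}^d$ of $\mathbb{Z}^d$ and positive integers $(a_i)_{i=1}^d$. Let $\mathcal{N}$ be the set of integers $n\ge1$ coprime with all the $a_i$. Then there exist a constant $C>0$ and a subset $G \subseteq \mathcal{N}$ containing almost all elements of $\mathcal{N}$, i.e. $$\lim_{N\to\infty} \frac{|G\cap [1,N]|}{|\mathcal{N}\cap[1,N]|} = 1,$$ such that, as $n\to\infty$ along $n \in G$, $$\sup_{t > C\log n} \left\| P^t(0,\cdot) - U\right\|_{\mathrm{TV}} \longrightarrow 0.$$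
   Context: $\mathrm{GL}_d(\mathbb{Z})$ is the set of invertible $d\times d$ matrices with integer entries whose inverse has integer entries. A matrix is hyperbolic if it has no (complex) eigenvalue of modulus $1$. $\operatorname{supp}\mu - \operatorname{supp}\mu = \{x-y : x,y \in \operatorname{supp}\mu\}$. A basis of $\mathbb{Z}^d$ means a family of $d$ elements generating $\mathbb{Z}^d$ as a group. For probability measures $p,q$ on a finite set $X$, $\|p-q\|_{\mathrm{TV}} = \max_{S \subseteq X} |p(S)-q(S)| = \frac12 \sum_{x\in X} |p(x)-q(x)|$. $\log$ is the natural logarithm. *)

(* Defs.v *)
From HB Require Import structures.
From mathcomp Require Import all_boot all_order all_algebra.
From mathcomp Require Import finmap complex.
From mathcomp Require Import all_classical all_reals all_analysis.

Set Implicit Arguments.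
Unset Strict Implicit.
Unset Printing Implicit Defensive.

Import Order.TTheory GRing.Theory Num.Theory.
Import numFieldNormedType.Exports.

Local Open Scope classical_set_scope.
Local Open Scope ring_scope.

HB.instance Definition _ := isPointed.Build int 0.

(* Integer matrices, in particular the column vectors of Z^d, carry the
   discrete sigma-algebra. *)
HB.instance Definition _ (m n : nat) :=
  @isMeasurable.Build default_measure_display 'M[int]_(m, n)
    discrete_measurable discrete_measurable0
    discrete_measurableC discrete_measurableU.

Definition subgroup (V : zmodType) (G : set V) : Prop :=
  G 0 /\ forall x y, G x -> G y -> G (x - y).

Definition generated (V : zmodType) (S : set V) : set V :=
  smallest (@subgroup V) S.

Definition invariant_subgroup (d : nat) (A : 'M[int]_d) (G : set 'cV[int]_d) :
    Prop :=
  subgroup G /\ forall x, G x -> G (A *m x).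

Definition Z_independent (V : zmodType) (r : nat) (v : 'I_r -> V) : Prop :=
  forall c : 'I_r -> int, \sum_i v i *~ c i = 0 -> forall i, c i = 0.

Definition has_rank (V : zmodType) (G : set V) (r : nat) : Prop :=
  (exists v : 'I_r -> V, (forall i, G (v i)) /\ Z_independent v) /\
  (forall (k : nat) (v : 'I_k -> V),
     (forall i, G (v i)) -> Z_independent v -> (k <= r)%N).

Definition Z_basis (d : nat) (u : 'I_d -> 'cV[int]_d) : Prop :=
  generated (range u) = setT.

(* [eigenvalue] refers to row eigenvectors; a square matrix has the same
   eigenvalues on rows and on columns. *)
Definition hyperbolic (R : realType) (d : nat) (A : 'M[int]_d) : Prop :=
  forall z : R[i], eigenvalue (map_mx intr A) z -> `|z| != 1.

Definition supp (R : realType) (d : nat) (mu : probability 'cV[int]_d R) :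
    set 'cV[int]_d :=
  [set x | (0 < mu [set x])%E].

Definition differences (V : zmodType) (S : set V) : set V :=
  [set x - y | x in S & y in S].

Definition step_subgroup (R : realType) (d : nat)
    (mu : probability 'cV[int]_d R) (A : 'M[int]_d) : set 'cV[int]_d :=
  smallest (invariant_subgroup A) (differences (supp mu)).

Definition independent (dO dT : measure_display) (O : measurableType dO)
    (T : measurableType dT) (R : realType) (P : probability O R)
    (I : choiceType) (X : I -> {RV P >-> T}) : Prop :=
  forall (J : {fset I}) (E : I -> set T), (forall i, measurable (E i)) ->
    P (\bigcap_(i in [set` J]) (X i @^-1` E i)) =
    (\prod_(i <- J) P (X i @^-1` E i))%E.

Definition iid (dO dT : measure_display) (O : measurableType dO)
    (T : measurableType dT) (R : realType) (P : probability O R)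
    (I : choiceType) (X : I -> {RV P >-> T}) (mu : probability T R) : Prop :=
  independent X /\
  forall i E, measurable E -> distribution P (X i) E = mu E.

(* (Z/nZ)^d, for n >= 1, by its representatives in {0, ..., n-1}^d.  The
   bound n.-1.+1 is n; unlike 'Z_n, it is also right for n = 1. *)
Notation torus n d := 'cV['I_n.-1.+1]_d.

Definition reduce (n d : nat) (v : 'cV[int]_d) : torus n d :=
  \col_i inord `|(v i ord0 %% n%:Z)%Z|%N.

Definition lift_torus (n d : nat) (x : torus n d) : 'cV[int]_d :=
  \col_i (x i ord0 : nat)%:Z.

(* The increments are b 1, b 2, ...; b 0 is not used. *)
Fixpoint walk (n d : nat) (A : 'M[int]_d) (b : nat -> 'cV[int]_d) (t : nat) :
    torus n d :=
  if t is s.+1 then reduce n (A *m lift_torus (walk n A b s) + b s.+1)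
  else reduce n 0.

Definition law_pmf (dO : measure_display) (O : measurableType dO) (R : realType)
    (P : probability O R) (X : finType) (f : O -> X) (x : X) : R :=
  fine (P (f @^-1` [set x])).

Definition uniform_pmf (R : realType) (X : finType) (x : X) : R := #|X|%:R^-1.

Definition tv (R : realType) (X : finType) (p q : X -> R) : R :=
  2%:R^-1 * \sum_x `|p x - q x|.

Definition coprime_to_all (d : nat) (a : 'I_d -> nat) : set nat :=
  [set n | (1 <= n)%N /\ forall i, coprime n (a i)].

Definition count_upto (S : set nat) (N : nat) : nat :=
  count (fun n => n \in S) (iota 1 N).

(* Main.v *)
Require Import Defs.
From mathcomp Require Import all_boot all_order all_algebra.
From mathcomp Require Import finmap complex.
From mathcomp Require Import all_classical all_reals all_analysis.
From mathcomp Require Import zify ring lra.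
Import Order.TTheory GRing.Theory Num.Theory.
Import numFieldNormedType.Exports.
Local Open Scope classical_set_scope.
Local Open Scope ring_scope.

Set Implicit Arguments.
Unset Strict Implicit.
Unset Printing Implicit Defensive.

(** Write psi for the Fourier transform of the step law mod n.  The transform of
    the law of X_t at a frequency xi is the product of psi (xi A^s) over s < t
    ([fourier_walk]), and Fourier inversion bounds the distance to the uniform
    law by the sum of the moduli of these products over xi <> 0 ([tv_fourier]).
    The task is to show that the orbit xi, xi A, xi A^2, ... often meets the set
    where |psi| <= rho, for some fixed rho < 1.

    |psi (xi)| is close to 1 only when xi v is close to n Z for the differences v
    of points of the support.  If this happens at J successive times, it passes
    to the A-invariant subgroup H generated by the differences, hence to its
    basis a_i u_i ([controlled_step_subgroup]).  In the coordinates
    eta_i = xi (a_i u_i), the matrix A becomes an integer matrix A', conjugate to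
    A over the rationals, so hyperbolic and unimodular ([conjugate_matrix]); and
    eta is not divisible by n when xi is not, because n is coprime to the a_i
    ([coprime_divides]).

    The orbit of eta is coded by digits.  The centred representatives c_s of
    eta A'^s modulo n satisfy c_(s+1) = c_s A' - n k_s, where the integer vector
    k_s runs over a finite alphabet and vanishes as soon as c_s and c_(s+1) are
    small compared with n.  So every nonzero digit is paid for by a factor
    |psi| <= rho within a bounded time ([digit_decay], [product_decay]).  Conversely
    digits determine the orbit: if two orbits, of denominators q and q', have the
    same digits for a time 2 L m, then their difference is a bounded orbit of the
    linear map A' during that time, so hyperbolicity divides it by 2^m in
    the middle ([hyperbolic_contraction]), whereas distinct rational points
    with these denominators are at distance at least 1/(q q').  Hence the
    denominators q between 2^k and 2^(k+1) that admit a primitive orbit with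
    abnormally few nonzero digits during a time proportional to k inject into the
    words with few nonzero letters, and there are at most (3/2)^(k+1) of them
    ([count_exceptional]).  The sum of 1/q over these exceptional q converges, so
    almost all n have no exceptional divisor of level k above a bound kappa that
    tends to infinity with n, say about log log n ([avoiding_density]).

    For such n, a frequency whose reduced denominator has level at least kappa
    has at least c log n nonzero digits, with c as large as desired when C is
    large; this beats the number n^d of frequencies.  The reduced denominators of
    the other frequencies are below 2^kappa <= log_2 n, so there are at most
    2^(kappa (d+1)) of these frequencies, and each has a nonzero digit in every
    window of length proportional to kappa, which is enough since log n / kappa is
    much larger than kappa ([mixing_bound]). *)

(** * Bounded orbits of a hyperbolic matrix are small in the middle *)

Local Notation normc := ComplexField.Normc.normc.

Lemma exp_lt_eps (R : realType) (x eps : R) : 0 <= x -> x < 1 -> 0 < eps ->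
  exists r : nat, x ^+ r <= eps.
Proof.
move=> x0 x1 e0.
have /cvg_expr/cvgrPdist_le/(_ eps e0) [N _ HN] : `|x| < 1 by rewrite ger0_norm.
exists N; have := HN N (leqnn N); rewrite /= sub0r normrN ger0_norm //.
by apply: exprn_ge0.
Qed.

(** The product of the operators (shift - r), for r in [rs], applied to [f]. *)
Fixpoint shift_diff (R : realType) (rs : seq R[i]) (f : nat -> R[i]) :=
  if rs is r :: rs' then shift_diff rs' (fun s => f s.+1 - r * f s) else f.

Lemma eq_shift_diff (R : realType) (rs : seq R[i]) f g :
  f =1 g -> shift_diff rs f =1 shift_diff rs g.
Proof.
elim: rs f g => [|r rs IH] f g fg //=.
by apply: IH => s; rewrite !fg.
Qed.

Lemma shift_diff_shift (R : realType) (rs : seq R[i]) f i s :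
  shift_diff rs (fun s => f (i + s)%N) s = shift_diff rs f (i + s)%N.
Proof.
elim: rs f s => [|r rs IH] f s //=.
rewrite -IH; apply: eq_shift_diff => u /=.
by rewrite addnS.
Qed.

Lemma forward_decay (R : realType) (l : R[i]) (f : nat -> R[i]) (e : R) a i :
  normc l <= 1 ->
  (forall s, (a <= s < a + i)%N -> normc (f s.+1 - l * f s) <= e) ->
  normc (f (a + i)%N) <= normc l ^+ i * normc (f a) + e *+ i.
Proof.
move=> l1; elim: i => [|i IH] Hg.
  by rewrite addn0 expr0 mul1r mulr0n addr0.
have l0 : 0 <= normc l by apply: (@normr_ge0 _ (Rcomplex R)).
have e0 : 0 <= e.
  by apply: le_trans (Hg a _); [apply: (@normr_ge0 _ (Rcomplex R)) | lia].
have := IH (fun s hs => Hg s ltac:(lia)).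
have := Hg (a + i)%N ltac:(lia).
rewrite addnS -[in normc (f _.+1)](subrK (l * f (a + i)%N) (f (a + i).+1)).
move: (f (a + i).+1 - _) => g H1 H2.
apply: le_trans (le_normcD _ _) _ => //.
rewrite ComplexField.Normc.normcM.
have H3 := ler_wpM2l l0 H2.
have H4 : normc l * (e *+ i) <= e *+ i by apply: ler_piMl => //; apply: mulrn_wge0.
rewrite exprS mulrSr.
rewrite mulrDr mulrA in H3.
lra.
Qed.

Lemma backward_decay (R : realType) (l : R[i]) (f : nat -> R[i]) (e : R) a i :
  1 < normc l ->
  (forall s, (a <= s < a + i)%N -> normc (f s.+1 - l * f s) <= e) ->
  normc (f a) <= (normc l)^-1 ^+ i * normc (f (a + i)%N) + e *+ i.
Proof.
move=> l1; elim: i a => [|i IH] a Hg.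
  by rewrite addn0 expr0 mul1r mulr0n addr0.
have l0 : 0 < normc l by lra.
have li1 : (normc l)^-1 <= 1 by rewrite invf_le1 // ltW.
have li0 : 0 <= (normc l)^-1 by rewrite invr_ge0 ltW.
have := IH a.+1 (fun s hs => Hg s ltac:(lia)).
have Ha := Hg a ltac:(lia).
have e0 : 0 <= e by apply: le_trans Ha; apply: (@normr_ge0 _ (Rcomplex R)).
rewrite addSn -addnS => H.
have : normc l * normc (f a) <= normc (f a.+1) + e.
  rewrite -ComplexField.Normc.normcM.
  have -> : l * f a = f a.+1 + - (f a.+1 - l * f a) by ring.
  apply: le_trans (le_normcD _ _) _; rewrite normcN; lra.
rewrite -ler_pdivlMl // => H2.
apply: le_trans H2 _.
have H3 := ler_wpM2l li0 H.
rewrite !mulrDr mulrA -exprS in H3 *.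
have H4 : (normc l)^-1 * (e *+ i) <= e *+ i by apply: ler_piMl => //; apply: mulrn_wge0.
have H5 : (normc l)^-1 * e <= e by apply: ler_piMl.
rewrite mulrSr; lra.
Qed.

(** Induction on the roots: the sequence obtained by applying (shift - l) is
    annihilated by the remaining factors, so it is small in a long middle window,
    and there the recurrence f (s+1) = l f s + small contracts forwards if |l| < 1
    and backwards if |l| > 1. *)
Lemma hyperbolic_recurrence (R : realType) (rs : seq R[i]) :
  (forall r, r \in rs -> normc r != 1) ->
  forall eps : R, 0 < eps -> exists L : nat, forall (f : nat -> R[i]) (M : R),
    (forall s, (s <= L.*2)%N -> normc (f s) <= M) ->
    (forall s, shift_diff rs f s = 0) -> normc (f L) <= eps * M.
Proof.
elim: rs => [|l rs IH] Hrs eps e0 /=.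
  exists 0%N => f M HM H0; rewrite H0 ComplexField.Normc.normc0.
  apply: mulr_ge0; first exact: ltW.
  by apply: le_trans (HM 0%N _) => //; apply: (@normr_ge0 _ (Rcomplex R)).
have l1 : normc l != 1 by apply: Hrs; rewrite inE eqxx.
have l0 : 0 <= normc l by apply: (@normr_ge0 _ (Rcomplex R)).
have Hrs' : forall r, r \in rs -> normc r != 1.
  by move=> r hr; apply: Hrs; rewrite inE hr orbT.
pose x := if normc l < 1 then normc l else (normc l)^-1.
have [x0 x1] : 0 <= x /\ x < 1.
  rewrite /x; case: ltP => // h; split; first by rewrite invr_ge0.
  by rewrite invf_lt1 ?lt_def ?l1 //; lra.
have [r Hr] := exp_lt_eps x0 x1 (divr_gt0 e0 (ltr0n R 2)).
have d0 : 0 < (1 + normc l) * (2 * r%:R + 1).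
  by apply: mulr_gt0; first lra; have := ler0n R r; lra.
have [L HL] := IH Hrs' (eps / ((1 + normc l) * (2 * r%:R + 1))) (divr_gt0 e0 d0).
(* [L] makes the differenced sequence small, on a window of width [2 r] around
   [L + r]; [r] steps of contraction then remain on either side. *)
exists (L + r)%N => f M HM H0.
pose e := eps / ((1 + normc l) * (2 * r%:R + 1)) * (M * (1 + normc l)).
have M0 : 0 <= M by apply: le_trans (HM 0%N _) => //; apply: (@normr_ge0 _ (Rcomplex R)).
have Hg i : (i < r.*2)%N -> normc (f (L + i).+1 - l * f (L + i)%N) <= e.
  move=> ir; rewrite addnC.
  apply: (HL (fun s => f (i + s).+1 - l * f (i + s)%N) (M * (1 + normc l))).
    move=> s hs; apply: le_trans (le_normcD _ _) _.
    rewrite normcN ComplexField.Normc.normcM mulrDr mulr1.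
    apply: lerD; first by apply: HM; move: ir hs; clear; lia.
    rewrite mulrC; apply: ler_wpM2r => //.
    by apply: HM; move: ir hs; clear; lia.
  by move=> s; rewrite (shift_diff_shift _ (fun s => f s.+1 - l * f s)).
have er : e *+ r <= eps / 2 * M.
  have r0 := ler0n R r.
  have E : e * (2 * r%:R + 1) = eps * M.
    by rewrite /e; field; apply/andP; split; lra.
  have e1 : 0 <= e by rewrite /e; apply: mulr_ge0; [exact/ltW/divr_gt0 | apply: mulr_ge0; lra].
  rewrite -mulr_natr; lra.
have fin y : normc (f y) <= M -> x ^+ r * normc (f y) + e *+ r <= eps * M.
  move=> hy; have -> : eps * M = eps / 2 * M + eps / 2 * M by field.
  apply: lerD => //; apply: ler_pM => //; first exact: exprn_ge0.
  exact: (@normr_ge0 _ (Rcomplex R)).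
(* Contract from the left end of the window, or from the right end. *)
have [l1'|l1'] := ltP (normc l) 1.
  apply: le_trans (fin L _); last by apply: HM; clear; lia.
  rewrite /x l1'; apply: forward_decay; first exact: ltW.
  move=> s /andP[h1 h2]; rewrite -(subnKC h1); apply: Hg.
  by move: h1 h2; clear; lia.
apply: le_trans (fin (L + r + r)%N _); last by apply: HM; clear; lia.
rewrite /x ltNge l1' /=; apply: backward_decay; first by rewrite lt_def l1.
move=> s /andP[h1 h2].
have -> : s = (L + (s - L))%N by rewrite subnKC // (leq_trans _ h1) ?leq_addr.
by apply: Hg; move: h1 h2; clear; lia.
Qed.

Lemma shift_diff_mx (R : realType) d (B : 'M[R[i]]_d) j rs (z : 'rV[R[i]]_d) s :
  shift_diff rs (fun s => (z *m B ^+ s) 0 j) s =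
  (z *m \prod_(r <- rs) (B - r%:M) *m B ^+ s) 0 j.
Proof.
elim: rs z s => [|r rs IH] z s /=; first by rewrite big_nil mulmx1.
rewrite big_cons.
have -> : z *m ((B - r%:M) * \prod_(r0 <- rs) (B - r0%:M)) *m B ^+ s =
  z *m (B - r%:M) *m \prod_(r0 <- rs) (B - r0%:M) *m B ^+ s
  by rewrite -mulmxE !mulmxA.
rewrite -IH; apply: eq_shift_diff => u /=.
have -> : B ^+ u.+1 = B *m B ^+ u by rewrite exprS.
rewrite mulmxA mulmxBr mulmxBl mul_mx_scalar -scalemxAl.
by rewrite [RHS]mxE [X in _ = _ + X]mxE [X in _ = _ - X]mxE.
Qed.

(** By Cayley-Hamilton every coordinate of z A^s is a linear recurrent sequence whose
    characteristic roots are the eigenvalues of A, none of modulus 1. *)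
Lemma hyperbolic_contraction (R : realType) d (A : 'M[int]_d.+1) : hyperbolic R A ->
  exists2 L, (0 < L)%N & forall (z : 'rV[int]_d.+1) (M : R),
    (forall s j, (s <= L.*2)%N -> `|(z *m A ^+ s) 0 j|%:~R <= M) ->
    forall j, `|(z *m A ^+ L) 0 j|%:~R <= M / 2.
Proof.
move=> hA; pose B : 'M[R[i]]_d.+1 := map_mx intr A.
have [rs Hrs] := closed_field_poly_normal (char_poly B).
have mon := char_poly_monic B.
rewrite (monicP mon) scale1r in Hrs.
have rs1 r : r \in rs -> normc r != 1.
  move=> hr; have := hA r; rewrite eigenvalue_root_char -/B Hrs root_prod_XsubC hr.
  by move=> /(_ isT); apply: contra => /eqP h; rewrite /Num.norm /= h.
have H0 : \prod_(r <- rs) (B - r%:M) = 0.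
  have := Cayley_Hamilton B; rewrite Hrs rmorph_prod /= => <-.
  by apply: eq_bigr => r _; rewrite rmorphB /= horner_mx_X horner_mx_C.
have h0 : (0 < 2^-1 :> R) by rewrite invr_gt0 ltr0n.
have [L HL] := hyperbolic_recurrence rs1 h0.
have main (z : 'rV[int]_d.+1) (M : R) :
    (forall s j, (s <= L.*2)%N -> `|(z *m A ^+ s) 0 j|%:~R <= M) ->
    forall j, `|(z *m A ^+ L) 0 j|%:~R <= M / 2.
  move=> HM j.
  pose z' : 'rV[R[i]]_d.+1 := map_mx intr z.
  have E s : (z' *m B ^+ s) 0 j = ((z *m A ^+ s) 0 j)%:~R.
    have -> : B ^+ s = map_mx intr (A ^+ s) by rewrite rmorphXn.
    by rewrite /z' -map_mxM mxE.
  have N (k : int) : normc (k%:~R : R[i]) = `|k|%:~R.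
    have : `|k%:~R : R[i]| = `|k|%:~R by rewrite intr_norm.
    by rewrite /Num.norm /= -[RHS](rmorph_int (real_complex R)) => -[].
  rewrite -N -E [M / 2]mulrC; apply: (HL (fun s => (z' *m B ^+ s) 0 j)).
    by move=> s hs; rewrite E N; apply: HM.
  move=> s; rewrite (shift_diff_mx B j rs z') H0 mulmx0 mul0mx mxE //.
exists L => //; case: (posnP L) => // L0; rewrite {}L0 in main.
(* [L = 0] is impossible: it would halve a bound attained by a unit vector. *)
have := main (delta_mx 0 0) 1 _ 0; rewrite expr0 mulmx1 !mxE /= normr1 => h.
have : (1 : R) <= 1 / 2.
  apply: h => s j; rewrite leqn0 => /eqP ->.
  by rewrite expr0 mulmx1 !mxE; case: (_ && _); rewrite ?normr1 ?normr0 ?ler01.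
lra.
Qed.

(** Iterating the contraction m times leaves a bound M / 2^m < 1 on an integer vector. *)
Definition vanishing d (A : 'M[int]_d.+1) (L : nat) :=
  forall (m : nat) (z : 'rV[int]_d.+1) (M : nat),
    (forall s j, (s <= (L * m).*2)%N -> `|(z *m A ^+ s) 0 j| <= M%:Z) ->
    (M < 2 ^ m)%N -> z *m A ^+ (L * m) = 0.

Lemma hyperbolic_vanish (R : realType) d (A : 'M[int]_d.+1) : hyperbolic R A ->
  exists2 L, (0 < L)%N & vanishing A L.
Proof.
move=> /hyperbolic_contraction [L L0 HL]; exists L => // m z M HM Mm.
suff H : forall (z : 'rV[int]_d.+1),
    (forall s j, (s <= (L * m).*2)%N -> `|(z *m A ^+ s) 0 j| <= M%:Z) ->
    forall j, (`|(z *m A ^+ (L * m)) 0 j|%:~R : R) <= M%:R / 2 ^+ m.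
  apply/rowP => j; rewrite [RHS]mxE; apply/eqP; rewrite -normr_eq0.
  have := H z HM j; rewrite ler_pdivlMr ?exprn_gt0 ?ltr0n //.
  have M2 : (M%:R : R) < 2 ^+ m by rewrite -natrX ltr_nat.
  move=> h; have {h M2} := le_lt_trans h M2.
  rewrite -subr_gt0; set x := `|_|.
  have : 0 <= x by rewrite normr_ge0.
  case: (ltrgt0P x) => // x0 _.
  have : (1 : R) <= x%:~R by rewrite -[1]/(1%:~R) ler_int; lia.
  have : (0 : R) < 2 ^+ m by rewrite exprn_gt0.
  nra.
clear z HM Mm; elim: m => [|m IH] z HM j.
  rewrite muln0 !expr0 divr1.
  rewrite -[M%:R]/(M%:Z%:~R) ler_int.
  by have := HM 0%N j; rewrite muln0 expr0; apply.
have -> : z *m A ^+ (L * m.+1) = z *m A ^+ (L * m) *m A ^+ L.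
  by rewrite -mulmxA mulmxE -exprD mulnS addnC.
have -> : M%:R / 2 ^+ m.+1 = M%:R / 2 ^+ m / 2 :> R by rewrite exprSr invfM mulrA.
apply: HL => s k hs.
have -> : z *m A ^+ (L * m) *m A ^+ s = z *m A ^+ s *m A ^+ (L * m).
  by rewrite -!mulmxA mulmxE -!exprD addnC.
apply: IH => u i hu; rewrite -mulmxA mulmxE -exprD; apply: HM.
by rewrite mulnS; move: hs hu; clear; lia.
Qed.

(** * Digits of an orbit modulo n *)

(** The integer nearest to k / n.  The rounding is chosen so that it depends on the
    fraction k / n only, which makes digits invariant under reduction of fractions. *)
Definition nearest (n : nat) (k : int) : int := ((2 * k + n%:Z) %/ (2 * n%:Z))%Z.

Definition cent (n : nat) (k : int) : int := k - n%:Z * nearest n k.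

Lemma cent_bound n k : (0 < n)%N -> 2 * `|cent n k| <= n%:Z.
Proof.
move=> n0; rewrite /cent /nearest.
have h := divz_eq (2 * k + n%:Z) (2 * n%:Z).
have h1 := @modz_ge0 (2 * k + n%:Z) (2 * n%:Z) ltac:(lia).
have h2 := @ltz_pmod (2 * k + n%:Z) (2 * n%:Z) ltac:(lia).
move: h h1 h2; move: ((2 * k + n%:Z) %/ _)%Z => q; move: ((2 * k + n%:Z) %% _)%Z => r.
lia.
Qed.

Lemma cent_min n k m : (0 < n)%N -> `|cent n k| <= `|k - n%:Z * m|.
Proof.
move=> n0; have := cent_bound k n0; rewrite /cent.
move: (nearest n k) => q h.
have [->//|mq] := eqVneq m q.
have : n%:Z <= `|n%:Z * (m - q)|.
  by rewrite normrM ler_peMr; lia.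
lia.
Qed.

Lemma nearest_scale g n k : (0 < g)%N -> nearest (g * n) (g%:Z * k) = nearest n k.
Proof.
move=> g0; rewrite /nearest -(@divzMpl g (2 * k + n%:Z)); last by lia.
by congr (_ %/ _)%Z; lia.
Qed.

Section Digits.
Variables (d : nat) (A : 'M[int]_d.+1).
Implicit Types (v w : 'rV[int]_d.+1) (n q s t : nat).

(** The carry k_s of the coding, for the vector v = eta A^s. *)
Definition digit n v := map_mx (nearest n) (v *m A) - map_mx (nearest n) v *m A.

Definition nonzero_digits n v t := (\sum_(s < t) (digit n (v *m A ^+ s) != 0%R))%N.

(** A bound both for the digits and for the inverse scale below which they vanish. *)
Definition entry_mass : nat := (1 + \sum_i \sum_j `|A i j|)%N.

(** The defining relation n k_s = c_s A - c_(s+1) between digits and centred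
    representatives. *)
Lemma digitE n v :
  n%:Z *: digit n v = map_mx (cent n) v *m A - map_mx (cent n) (v *m A).
Proof.
have E u : map_mx (cent n) u = u - n%:Z *: map_mx (nearest n) u :> 'rV_d.+1.
  by apply/rowP => j; rewrite !mxE.
by rewrite !E mulmxBl -scalemxAl scalerBr opprB [RHS]addrC subrKA.
Qed.

Lemma digit_bound n v (B : nat) : (0 < n)%N ->
  (forall j, B%:Z * `|cent n (v 0 j)| <= n%:Z) ->
  (forall j, B%:Z * `|cent n ((v *m A) 0 j)| <= n%:Z) ->
  forall j, B%:Z * `|digit n v 0 j| <= entry_mass%:Z.
Proof.
move=> n0 H1 H2 j.
have E : n%:Z * digit n v 0 j =
    (map_mx (cent n) v *m A) 0 j - cent n ((v *m A) 0 j).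
  have := congr1 (fun u : 'rV_d.+1 => u 0 j) (digitE n v).
  by rewrite mxE [RHS]mxE [X in _ + X]mxE [X in _ - X]mxE.
move: (H2 j) E; move: (cent n ((v *m A) 0 j)) => c H2' E.
rewrite -(@ler_pM2l _ n%:Z) //.
rewrite mulrCA -[n%:Z * `|_|](_ : `|n%:Z * digit n v 0 j| = _); last first.
  by rewrite normrM ger0_norm.
rewrite E mxE; apply: le_trans (_ : B%:Z * (`|\sum_k (map_mx (cent n) v) 0 k * A k j| + `|c|) <= _).
  by apply: ler_wpM2l => //; apply: ler_normB.
rewrite mulrDr /entry_mass PoszD mulrDr mulr1 addrC; apply: lerD => //.
apply: le_trans (_ : B%:Z * (\sum_k `|map_mx (cent n) v 0 k| * `|A k j|) <= _).
  apply: ler_wpM2l => //; apply: le_trans (ler_norm_sum _ _ _) _.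
  by apply: ler_sum => k _; rewrite normrM.
rewrite mulr_sumr (big_morph Posz PoszD (erefl _)) mulr_sumr; apply: ler_sum => k _.
rewrite mxE mulrA (bigD1 j) //= PoszD mulrDr abszE.
apply: le_trans (_ : n%:Z * `|A k j| <= _); first by apply: ler_wpM2r.
by rewrite ler_wpDr // mulr_ge0.
Qed.

Lemma digit_le n v j : (0 < n)%N -> `|digit n v 0 j| <= entry_mass%:Z.
Proof.
move=> n0; have := @digit_bound n v 2 n0 (fun j => cent_bound _ n0) (fun j => cent_bound _ n0) j.
lia.
Qed.

Lemma digit_eq0 n v : (0 < n)%N ->
  (forall j, exists m, (2 * entry_mass)%:Z * `|v 0 j - n%:Z * m| <= n%:Z) ->
  (forall j, exists m, (2 * entry_mass)%:Z * `|(v *m A) 0 j - n%:Z * m| <= n%:Z) ->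
  digit n v = 0.
Proof.
move=> n0 H1 H2.
have aux u : (exists m, (2 * entry_mass)%:Z * `|u - n%:Z * m| <= n%:Z) ->
    (2 * entry_mass)%:Z * `|cent n u| <= n%:Z.
  by move=> [m]; apply: le_trans; apply: ler_wpM2l => //; apply: cent_min.
apply/rowP => j; rewrite [RHS]mxE.
have := digit_bound n0 (fun j => aux _ (H1 j)) (fun j => aux _ (H2 j)) j.
have : (0 < entry_mass)%N by [].
move: entry_mass (digit n v 0 j) => W x; nia.
Qed.

Lemma digit_scale g n v : (0 < g)%N -> digit (g * n) (g%:Z *: v) = digit n v.
Proof.
move=> g0; rewrite /digit -scalemxAl.
have E u : map_mx (nearest (g * n)) (g%:Z *: u) = map_mx (nearest n) u :> 'rV_d.+1.
  by apply/rowP => j; rewrite !mxE nearest_scale.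
by rewrite !E.
Qed.

Lemma nonzero_digits_scale g n v t : (0 < g)%N ->
  nonzero_digits (g * n) (g%:Z *: v) t = nonzero_digits n v t.
Proof.
by move=> g0; apply: eq_bigr => s _; rewrite -scalemxAl digit_scale.
Qed.

Lemma nonzero_digitsD n v t u :
  nonzero_digits n v (t + u) = (nonzero_digits n v t + nonzero_digits n (v *m A ^+ t) u)%N.
Proof.
rewrite /nonzero_digits big_split_ord /=; congr (_ + _)%N.
by apply: eq_bigr => s _; rewrite -mulmxA mulmxE -exprD.
Qed.

(** Cutting the time interval into windows of length T. *)
Lemma nonzero_digits_windows n v t T b :
  (forall s, (b <= nonzero_digits n (v *m A ^+ s) T)%N) ->
  (t %/ T * b <= nonzero_digits n v t)%N.
Proof.
move=> H; have Hk k w : (forall s, (b <= nonzero_digits n (w *m A ^+ s) T)%N) ->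
    (k * b <= nonzero_digits n w (k * T))%N.
  elim: k w => [|k IH] w Hw; first by rewrite mul0n.
  rewrite !mulSn nonzero_digitsD; apply: leq_add.
    by have := Hw 0%N; rewrite expr0 mulmx1.
  by apply: IH => s; rewrite -mulmxA mulmxE -exprD.
rewrite [X in nonzero_digits _ _ X](divn_eq t T) nonzero_digitsD.
exact: leq_trans (Hk _ _ H) (leq_addr _ _).
Qed.

(** Clearing denominators, the difference of two orbits with the same digits evolves
    linearly, without carries. *)
Lemma same_digits_orbit q q' v v' T :
  (forall s, (s < T)%N -> digit q (v *m A ^+ s) = digit q' (v' *m A ^+ s)) ->
  forall s, (s <= T)%N ->
  q'%:Z *: map_mx (cent q) (v *m A ^+ s) - q%:Z *: map_mx (cent q') (v' *m A ^+ s) =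
  (q'%:Z *: map_mx (cent q) v - q%:Z *: map_mx (cent q') v') *m A ^+ s.
Proof.
move=> H; elim=> [|s IH] hs; first by rewrite !expr0 !mulmx1.
have step p u : map_mx (cent p) (u *m A ^+ s.+1) =
    map_mx (cent p) (u *m A ^+ s) *m A - p%:Z *: digit p (u *m A ^+ s).
  have -> : u *m A ^+ s.+1 = u *m A ^+ s *m A by rewrite -mulmxA mulmxE -exprSr.
  by rewrite digitE opprB addrC subrK.
have E (X : 'rV_d.+1) : X *m A ^+ s.+1 = X *m A ^+ s *m A.
  by rewrite -mulmxA mulmxE -exprSr.
rewrite [RHS]E -IH; last exact: ltnW.
rewrite !step (H s hs); move: (digit q' _) => D.
rewrite mulmxBl !scalerBr -!scalemxAl !scalerA [q'%:Z * _]mulrC.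
by rewrite opprB subrKA.
Qed.

(** A Bezout form of gcd (n, v) = 1; it says that n is the exact denominator of v / n and
    is visibly preserved by unimodular matrices. *)
Definition primitive n v := exists (w : 'cV[int]_d.+1) (k : int), (v *m w) 0 0 + k * n%:Z = 1.

Lemma primitive_orbit n v s : A \in unitmx -> primitive n v -> primitive n (v *m A ^+ s).
Proof.
move=> uA [w [k E]]; exists (invmx (A ^+ s) *m w), k.
by rewrite mulmxA mulmxK // unitrX.
Qed.

(** A bounded orbit of integer vectors is zero in the middle of a long enough window, so
    digits determine the middle point. *)
Lemma same_digits_middle L q q' v v' m : vanishing A L -> (0 < q)%N -> (0 < q')%N ->
  (q * q' < 2 ^ m)%N ->
  (forall s, (s < (L * m).*2)%N -> digit q (v *m A ^+ s) = digit q' (v' *m A ^+ s)) ->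
  q'%:Z *: map_mx (cent q) (v *m A ^+ (L * m)) =
  q%:Z *: map_mx (cent q') (v' *m A ^+ (L * m)).
Proof.
move=> HL q0 q0' hm /same_digits_orbit H.
apply/eqP; rewrite -subr_eq0; apply/eqP; rewrite H; last by rewrite -addnn leq_addr.
apply: HL hm => s j hs; rewrite -H //.
rewrite 3![in X in `|X|]mxE [X in _ + X]mxE [X in - X]mxE [map_mx _ _ _ _]mxE.
apply: le_trans (ler_normB _ _) _; rewrite !normrM (@ger0_norm _ q%:Z) // (@ger0_norm _ q'%:Z) //.
have h1 := cent_bound ((v *m A ^+ s) 0 j) q0.
have h2 := cent_bound ((v' *m A ^+ s) 0 j) q0'.
move: h1 h2; move: (`|cent q _|) (`|cent q' _|) => x y h1 h2.
have h3 : q'%:Z * (2 * x) <= q'%:Z * q%:Z by apply: ler_wpM2l.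
have h4 : q%:Z * (2 * y) <= q%:Z * q'%:Z by apply: ler_wpM2l.
lia.
Qed.

(** Two equal fractions: a denominator in lowest terms divides the other one. *)
Lemma primitive_dvd q q' v v' : primitive q v ->
  q'%:Z *: map_mx (cent q) v = q%:Z *: v' -> (q %| q')%N.
Proof.
move=> [w [k E]] H.
have : q'%:Z *: v = q%:Z *: (v' + q'%:Z *: map_mx (nearest q) v).
  rewrite scalerDr -H; apply/rowP => j; rewrite !mxE /cent; ring.
move=> /(congr1 (fun u => (u *m w) 0 0)).
rewrite -!scalemxAl mxE [RHS]mxE => E2.
have : q'%:Z = q%:Z * (((v' + q'%:Z *: map_mx (nearest q) v) *m w) 0 0 + k * q'%:Z).
  by rewrite mulrDr -E2 mulrCA mulrA -[LHS]mulr1 -E mulrDr; ring.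
by move=> h; have : (q%:Z %| q'%:Z)%Z by rewrite h dvdz_mulr.
Qed.

(** An orbit without nonzero digits has the same digits as the orbit of 0. *)
Lemma exists_nonzero_digit L n v k : vanishing A L -> A \in unitmx -> (0 < n < 2 ^ k)%N ->
  ~ (exists u, v = n%:Z *: u) -> (0 < nonzero_digits n v (L * k).*2)%N.
Proof.
move=> HL uA /andP[n0 nk] Hv; rewrite lt0n; apply/negP => /eqP H; apply: Hv.
have Hd s : (s < (L * k).*2)%N -> digit n (v *m A ^+ s) = 0.
  move=> hs; move/eqP: H; rewrite /nonzero_digits sum_nat_eq0 => /forallP /(_ (Ordinal hs)) /=.
  by rewrite eqb0 negbK => /eqP.
have z0 : digit 1 (0 : 'rV[int]_d.+1) = 0.
  rewrite /digit mul0mx; have -> : map_mx (nearest 1) 0 = 0 :> 'rV[int]_d.+1.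
    by apply/rowP => j; rewrite !mxE.
  by rewrite mul0mx subr0.
have := @same_digits_middle L n 1 v 0 k HL n0 isT.
rewrite muln1 mul0mx => /(_ nk) h.
have {h} : map_mx (cent n) (v *m A ^+ (L * k)) = 0.
  rewrite -[LHS]scale1r h; first by apply/rowP => j; rewrite !mxE mulr0.
  by move=> s hs; rewrite Hd // mul0mx z0.
move=> h; exists (map_mx (nearest n) (v *m A ^+ (L * k)) *m invmx (A ^+ (L * k))).
rewrite scalemxAl; apply: (canRL (mulmxK _)); first by rewrite unitrX.
apply/rowP => j; have := congr1 (fun u : 'rV_d.+1 => u 0 j) h.
by rewrite !mxE => /eqP; rewrite subr_eq0 => /eqP.
Qed.

End Digits.

(** * Counting exceptional denominators *)

Lemma leq_expl a b e : (a <= b -> a ^ e <= b ^ e)%N.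
Proof. by case: e => // e; rewrite leq_exp2r. Qed.

(** Exponential Markov inequality: weigh a word by M for each letter equal to [z]; sparse
    words have weight at least M^(T - r), and the total weight is a T-th power. *)
Lemma count_sparse_words (S : finType) (z : S) T M r : (0 < M)%N ->
  (#|[set w : {ffun 'I_T -> S} | \sum_s (w s != z) <= r]%SET| * M ^ T
    <= M ^ r * (M + #|S|) ^ T)%N.
Proof.
move=> M0; set W := [set w | _]%SET.
rewrite -sum_nat_const.
apply: (@leq_trans (\sum_(w in W) M ^ r * \prod_s (if w s == z then M else 1)))%N.
  apply: leq_sum => w; rewrite inE => hw.
  have -> : (\prod_s (if w s == z then M else 1) = M ^ \sum_s (w s == z))%N.
    by rewrite expn_sum; apply: eq_bigr => s _; case: eqP.
  rewrite -expnD leq_pexp2l //; apply: leq_trans (leq_add hw (leqnn _)).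
  rewrite -big_split /= -{1}[T]card_ord -sum1_card; apply: leq_sum => s _.
  by case: eqP.
rewrite -big_distrr /= leq_mul2l; apply/orP; right.
apply: (@leq_trans (\sum_(w : {ffun 'I_T -> S}) \prod_s (if w s == z then M else 1)))%N.
  by rewrite [leqRHS](bigID (mem W)) /= leq_addr.
rewrite -(bigA_distr_bigA (fun (s : 'I_T) (a : S) => if a == z then M else 1%N)) /=.
rewrite prod_nat_const card_ord; apply: leq_expl.
rewrite (bigD1 z) //= eqxx leq_add2l -sum1_card big_mkcond /=.
by apply: leq_sum => a _; case: eqP.
Qed.

(** The inequality (1 + x)^p (1 - p x) <= 1 for x = c / M, cleared of denominators. *)
Lemma bernoulli_nat M c p : ((M + c) ^ p * (M - p * c) <= M ^ p.+1)%N.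
Proof.
elim: p => [|p IH]; first by rewrite expn0 mul0n subn0 mul1n expn1.
have [h|h] := leqP (p.+1 * c) M; last first.
  by rewrite (_ : (M - _ = 0)%N) ?muln0 //; apply/eqP; rewrite subn_eq0 ltnW.
apply: leq_trans (_ : M * ((M + c) ^ p * (M - p * c)) <= _)%N; last first.
  by rewrite [leqRHS]expnS leq_mul2l IH orbT.
rewrite expnS -mulnA [leqRHS]mulnCA mulnCA leq_mul2l; apply/orP; right.
by rewrite mulSn in h *; nia.
Qed.

Lemma exp65_unbounded M : (M * 5 ^ (5 * M) <= 6 ^ (5 * M))%N.
Proof.
have H D : (5 ^ D * (5 + D) <= 5 * 6 ^ D)%N.
  elim: D => [//|D IH]; rewrite !expnS; nia.
by have := H (5 * M)%N; move: (5 ^ _)%N (6 ^ _)%N => a b; nia.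
Qed.

(** With M = 5 p c, the factor (1 + c / M)^p is at most 5/4, and a density of nonzero
    letters at most 1 / (5 M) keeps M^(K / D) below (6/5)^K; the product is (3/2)^K. *)
Lemma sparse_words_bound p c : (0 < p)%N -> (0 < c)%N -> exists D, forall K W,
  (0 < D)%N /\
  ((forall M, (0 < M)%N ->
     W * M ^ (p * K) <= M ^ (K %/ D) * (M + c) ^ (p * K)) -> W * 2 ^ K <= 3 ^ K)%N.
Proof.
move=> p0 c0; pose M := (5 * (p * c))%N; exists (5 * M)%N => K W.
have M0 : (0 < M)%N by rewrite /M !muln_gt0 p0 c0.
split; [by rewrite muln_gt0 M0 | move=> /(_ M M0) HW].
have h1 : (4 * (M + c) ^ p <= 5 * M ^ p)%N.
  have h : ((M + c) ^ p * (4 * (p * c)) <= 5 * (p * c) * M ^ p)%N.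
    rewrite -[(5 * (p * c))%N]/M -expnS (_ : 4 * (p * c) = M - p * c)%N ?bernoulli_nat //.
    by rewrite /M; lia.
  have x0 : (0 < p * c)%N by rewrite muln_gt0 p0 c0.
  rewrite -(leq_pmul2r x0); move: h; move: ((M + c) ^ p)%N (M ^ p)%N => y z.
  by clear; lia.
clearbody M.
have h2 : (M ^ (K %/ (5 * M)) * 5 ^ K <= 6 ^ K)%N.
  rewrite {2 3}(divn_eq K (5 * M)); move: (K %/ _)%N (K %% _)%N => q e.
  rewrite !expnD mulnA; apply: leq_mul; last exact: leq_expl.
  rewrite [(q * _)%N]mulnC [(6 ^ _)%N]expnM [(5 ^ _)%N]expnM -expnMn.
  exact: leq_expl (exp65_unbounded M).
have h3 := leq_expl K h1; rewrite !expnMn -!expnM in h3.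
have M1 : (0 < M ^ (p * K))%N by rewrite expn_gt0 M0.
have E4 : (4 ^ K = 2 ^ K * 2 ^ K)%N by rewrite -expnMn.
have E6 : (6 ^ K = 2 ^ K * 3 ^ K)%N by rewrite -expnMn.
have P2 : (0 < 2 ^ K)%N by rewrite expn_gt0.
have P5 : (0 < 5 ^ K)%N by rewrite expn_gt0.
rewrite -(leq_pmul2r M1) -(leq_pmul2r P2) -(leq_pmul2r P5).
move: HW h2 h3; rewrite E4 E6.
move: (M ^ (K %/ _))%N (M ^ (p * K))%N ((M + c) ^ (p * K))%N (2 ^ K)%N (3 ^ K)%N (5 ^ K)%N.
move=> a b e x y z h1' h2' h3'.
apply: leq_trans (_ : (a * z) * (x * x * e) <= _)%N.
  by have := leq_mul (leqnn (x * x * z)) h1'; congr (_ <= _)%N; ring.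
apply: leq_trans (leq_mul h2' h3') _.
by apply/eq_leq; ring.
Qed.

Section Exceptional.
Variables (d : nat) (A : 'M[int]_d.+1) (L : nat).

(** Shifts digits into the nonnegative range so as to get a finite alphabet. *)
Definition digit_code (u : 'rV[int]_d.+1) : {ffun 'I_d.+1 -> 'I_((entry_mass A).*2.+1)} :=
  [ffun j => inord `|(u 0 j + (entry_mass A)%:Z)%R|%N].

Lemma digit_code_inj (u u' : 'rV[int]_d.+1) :
  (forall j, `|u 0 j| <= (entry_mass A)%:Z) -> (forall j, `|u' 0 j| <= (entry_mass A)%:Z) ->
  digit_code u = digit_code u' -> u = u'.
Proof.
move=> h h' /ffunP E; apply/rowP => j.
have := E j; rewrite !ffunE => /(congr1 val) /=.
have := h j; have := h' j; move: (entry_mass A) => W h1 h2.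
rewrite !inordK; lia.
Qed.

(** The window has length 4 L K for q < 2^K: this is what recovers a point from its digits
    among all points with denominators below 2^K. *)
Definition exceptional (D q : nat) := exists v,
  primitive q v /\
  (nonzero_digits A q v (L * (trunc_log 2 q).+1.*2).*2 <= (trunc_log 2 q).+1 %/ D)%N.

(** Each exceptional q is recovered from the digit word of one of its sparse orbits: the
    middle points of two orbits with the same word agree, hence so do their exact
    denominators. *)
Lemma count_exceptional : vanishing A L -> A \in unitmx -> (0 < L)%N ->
  exists2 D, (0 < D)%N & forall k,
   (#|[set q : 'I_(2 ^ k.+1) | [&& 0 < q, trunc_log 2 q == k & `[<exceptional D q>]]]%SET|
     * 2 ^ k.+1 <= 3 ^ k.+1)%N.
Proof.
move=> HL uA L0.
pose S := {ffun 'I_d.+1 -> 'I_((entry_mass A).*2.+1)}.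
have S0 : (0 < #|{: S}|)%N by apply/card_gt0P; exists (digit_code 0).
have [D HD] := @sparse_words_bound (4 * L)%N #|{: S}| ltac:(lia) S0.
exists D; first by have [] := HD 0%N 0%N.
move=> k; apply: (HD k.+1 _).2 => M M0.
set T := (4 * L * k.+1)%N; set r := (k.+1 %/ D)%N.
apply: leq_trans (count_sparse_words (digit_code 0 : S) T r M0).
rewrite leq_mul2r; apply/orP; right.
set E := [set q | _]%SET.
have ET : T = (L * k.+1.*2).*2 by rewrite /T; lia.
pose vec (q : nat) := xget 0 [set v | primitive q v /\ (nonzero_digits A q v T <= r)%N].
pose f (q : 'I_(2 ^ k.+1)) : {ffun 'I_T -> S} :=
  [ffun s : 'I_T => digit_code (digit A q (vec q *m A ^+ s))].
have HE q : q \in E -> [/\ (0 < q)%N, primitive q (vec q) & (nonzero_digits A q (vec q) T <= r)%N].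
  rewrite inE => /and3P[q0 /eqP qk /asboolP[v [pv nv]]]; rewrite qk -ET in nv.
  have ex : exists v, primitive q v /\ (nonzero_digits A q v T <= r)%N by exists v.
  by have [] := xgetPex 0 ex.
have finj : {in E &, injective f}.
  move=> q q' /HE[q0 pq _] /HE[q0' pq' _] /ffunP Eff.
  have Hd s : (s < (L * k.+1.*2).*2)%N ->
      digit A q (vec q *m A ^+ s) = digit A q' (vec q' *m A ^+ s).
    rewrite -ET => hs; have := Eff (Ordinal hs); rewrite !ffunE /=.
    by apply: digit_code_inj => j; apply: digit_le.
  have qq : (q * q' < 2 ^ k.+1.*2)%N.
    by rewrite -addnn expnD; apply: ltn_mul; apply: ltn_ord.
  have h := same_digits_middle HL q0 q0' qq Hd.
  apply/val_inj/eqP; rewrite eqn_dvd; apply/andP; split.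
    exact: (primitive_dvd (primitive_orbit _ uA pq) h).
  exact: (primitive_dvd (primitive_orbit _ uA pq') (esym h)).
rewrite -(card_in_imset finj); apply/subset_leq_card/fintype.subsetP => w.
move=> /imsetP[q /HE[q0 pq nq] ->].
rewrite inE; apply: leq_trans nq; apply: leq_sum => s _; rewrite ffunE.
have [->|_] := eqVneq (digit A q (vec q *m A ^+ s)) 0; first by rewrite eqxx.
exact: leq_b1.
Qed.

Lemma gcd_combination m (v : 'I_m -> int) (n : nat) : exists (g : nat) (w : 'I_m -> int) (k : int),
  [/\ \sum_i v i * w i + k * n%:Z = g%:Z, (g%:Z %| n%:Z)%Z & forall i, (g%:Z %| v i)%Z].
Proof.
elim: m v => [|m IH] v.
  exists n, (fun=> 0), 1; split; [by rewrite big_ord0 add0r mul1r | exact: dvdzz | by case].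
have [g [w [k [E gn gv]]]] := IH (fun i => v (lift ord0 i)).
have [x [y Exy]] := Bezoutz g%:Z (v ord0).
exists `|gcdz g%:Z (v ord0)|%N.
have Eg : `|gcdz g%:Z (v ord0)|%N%:Z = gcdz g%:Z (v ord0) by [].
exists (fun i => if unlift ord0 i is Some j then x * w j else y), (x * k); rewrite Eg; split.
- rewrite big_ord_recl unlift_none -Exy -E.
  under eq_bigr do rewrite liftK mulrCA.
  by rewrite -mulr_sumr; ring.
- exact: dvdz_trans (dvdz_gcdl _ _) gn.
move=> i; case: (unliftP ord0 i) => [j|] ->; last exact: dvdz_gcdr.
exact: dvdz_trans (dvdz_gcdl _ _) (gv j).
Qed.

Lemma primitive_reduction n (v : 'rV[int]_d.+1) : (0 < n)%N ->
  exists g q w, [/\ n = (g * q)%N, v = g%:Z *: w & primitive q w].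
Proof.
move=> n0; have [g [w [k [E gn gv]]]] := gcd_combination (fun j => v 0 j) n.
have {gn} /dvdnP[q Eq] : (g %| n)%N by [].
have g0 : g%:Z != 0 by apply/eqP => -[g0]; move: Eq n0; rewrite g0 muln0 => ->.
exists g, q, (\row_j (v ord0 j %/ g%:Z)%Z); split; first by rewrite mulnC.
  by apply/rowP => j; rewrite !mxE mulrC divzK.
exists (\col_j w j), k.
apply: (mulIf g0); rewrite mul1r -[RHS]E mulrDl -mulrA Eq PoszM; congr (_ + _).
rewrite mxE mulr_suml; apply: eq_bigr => j _; rewrite !mxE.
by rewrite mulrAC divzK.
Qed.

End Exceptional.

(** * Density of the integers without large exceptional divisors *)

Lemma count_uptoE (S : set nat) N : count_upto S N = (\sum_(1 <= n < N.+1) (n \in S))%N.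
Proof.
rewrite /count_upto -sum1_count big_mkcond /= /index_iota subSS subn0.
by apply: eq_bigr => n _; case: (n \in S).
Qed.

(** The integers congruent to 1 modulo the product of the a_i are coprime to all of them. *)
Lemma count_coprime_lower d (a : 'I_d -> nat) N : (forall i, (0 < a i)%N) ->
  (N <= count_upto (coprime_to_all a) N * \prod_i a i)%N.
Proof.
move=> a0; case: N => [//|N].
have p0 : (0 < \prod_i a i)%N by rewrite prodn_gt0.
set p := (\prod_i a i)%N in p0 *.
apply: (@leq_trans ((1 + N %/ p) * p)); first by rewrite mulSn; have := ltn_ceil N p0; lia.
rewrite leq_mul2r; apply/orP; right; rewrite count_uptoE divn_count_dvd.
rewrite !big_add1 /= !big_mkord [leqRHS]big_ord_recl /=.
apply: leq_add.
  by rewrite mem_set //; split => // i; rewrite coprime1n.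
apply: leq_sum => i _; case: dvdnP => // -[k Ek].
rewrite lt0b; apply/mem_set; split => // j; rewrite /bump leq0n add1n Ek.
have [b Eb] : exists b, p = (b * a j)%N.
  by apply/dvdnP; rewrite /p (bigD1 j) //= dvdn_mulr.
by rewrite coprime_sym /coprime -addn1 Eb mulnA gcdnMDl gcdn1.
Qed.

(** About log log n: it tends to infinity, yet 2^(level_bound n) <= log_2 n. *)
Definition level_bound n := trunc_log 2 (trunc_log 2 n).

Definition avoiding (S X : set nat) : set nat :=
  [set n | S n /\ forall q, (0 < q)%N -> (q %| n)%N -> X q -> (trunc_log 2 q < level_bound n)%N].

Lemma level_bound_ge j n : (2 ^ (2 ^ j) <= n)%N -> (j <= level_bound n)%N.
Proof.
move=> h; have n0 : (0 < n)%N by apply: leq_trans h; rewrite expn_gt0.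
by rewrite /level_bound !trunc_log_max.
Qed.

(** Except for the first integers, below 2^(2^j), a missed n is a multiple of some exceptional
    q of level at least j. *)
Lemma count_avoiding (S X : set nat) j N :
  (count_upto S N <= count_upto (avoiding S X) N + (2 ^ (2 ^ j) +
    \sum_(j <= k < N) #|[set q : 'I_(2 ^ k.+1) |
       [&& 0 < q, trunc_log 2 q == k & `[<X q>]]]%SET| * (N %/ 2 ^ k)))%N.
Proof.
pose E k := [set q : 'I_(2 ^ k.+1) | [&& 0 < q, trunc_log 2 q == k & `[<X q>]]%N]%SET.
rewrite !count_uptoE.
apply: (@leq_trans (\sum_(1 <= n < N.+1) ((n \in avoiding S X) + ((n < 2 ^ (2 ^ j)) +
   \sum_(j <= k < N) \sum_(q in E k) (q %| n)))))%N.
  rewrite big_nat_cond [leqRHS]big_nat_cond; apply: leq_sum => n /andP[/andP[n1 nN] _].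
  case: (boolP (n \in S)) => // /set_mem Sn.
  case: (boolP (n \in avoiding S X)) => // /negP nG.
  case: ltnP => // hn; rewrite !add0n lt0n; apply/negP => /eqP H0; apply: nG.
  apply/mem_set; split => // q q0 qn Xq.
  apply: leq_trans (_ : j <= _)%N; last exact: level_bound_ge.
  rewrite ltnNge; apply/negP => jq.
  have qN : (q <= N)%N by rewrite (leq_trans (dvdn_leq _ qn)).
  have [/andP[tq1 tq2]] : (2 ^ trunc_log 2 q <= q < 2 ^ (trunc_log 2 q).+1)%N.
    exact: trunc_log_bounds.
  have tN : (trunc_log 2 q < N)%N by apply: leq_trans qN; apply: leq_trans tq1; apply: ltn_expl.
  move: H0; rewrite (bigD1_seq (trunc_log 2 q)) ?iota_uniq ?mem_index_iota ?jq //=.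
  rewrite (bigD1 (Ordinal tq2)) /=; last by rewrite inE q0 eqxx; apply/asboolP.
  by rewrite qn.
rewrite !big_split /= leq_add2l; apply: leq_add.
  apply: (@leq_trans (\sum_(0 <= n < 2 ^ (2 ^ j)) 1))%N; last first.
    by rewrite sum_nat_const_nat muln1 subn0.
  have [h|h] := leqP N.+1 (2 ^ (2 ^ j)).
    rewrite (@big_cat_nat _ _ _ N.+1 0 (2 ^ (2 ^ j))) //= (@big_cat_nat _ _ _ 1 0 N.+1) //=.
    apply: leq_trans (leq_addr _ _); apply: leq_trans (leq_addl _ _).
    by apply: leq_sum => n _; apply: leq_b1.
  rewrite (@big_cat_nat _ _ _ (2 ^ (2 ^ j)) 1 N.+1) //=; [|by rewrite expn_gt0|exact: ltnW].
  rewrite [X in (_ + X)%N]big_nat_cond [X in (_ + X)%N]big1 ?addn0; last first.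
    by move=> n /andP[/andP[h1 _] _]; rewrite ltnNge h1.
  rewrite [leqRHS](@big_cat_nat _ _ _ 1) ?expn_gt0 //=; apply: leq_trans (leq_addl _ _).
  by apply: leq_sum => n _; apply: leq_b1.
rewrite exchange_big_nat /=; apply: leq_sum => k _.
rewrite exchange_big /= -sum_nat_const; apply: leq_sum => q; rewrite inE => /and3P[q0 /eqP qk _].
rewrite -divn_count_dvd; apply: leq_div2l; first by rewrite expn_gt0.
by have := @trunc_logP 2 q isT q0; rewrite qk.
Qed.

(** The levels contribute at most a geometric series of ratio 3/4. *)
Lemma sum_count_levels (R : realType) (e : nat -> nat) j N :
  (forall k, e k * 2 ^ k.+1 <= 3 ^ k.+1)%N ->
  (\sum_(j <= k < N) e k * (N %/ 2 ^ k))%N%:R <= 6 * (3 / 4) ^+ j * N%:R :> R.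
Proof.
move=> He; have [jN|Nj] := leqP j N; last first.
  rewrite big_geq ?(ltnW Nj) // mulr_ge0 // mulr_ge0 // exprn_ge0 //; lra.
rewrite natr_sum.
apply: (@le_trans _ _ (\sum_(j <= k < N)
   ((- (6 * (3 / 4) ^+ k.+1 * N%:R)) - (- (6 * (3 / 4) ^+ k * N%:R))))).
  apply: ler_sum => k _.
  have h : ((e k)%:R : R) <= 3 ^+ k.+1 / 2 ^+ k.+1.
    by rewrite ler_pdivlMr ?exprn_gt0 // -!natrX -natrM ler_nat.
  have h2 : ((N %/ 2 ^ k)%N%:R : R) <= N%:R / 2 ^+ k.
    by rewrite ler_pdivlMr ?exprn_gt0 // -natrX -natrM ler_nat leq_divM.
  rewrite natrM; apply: le_trans (ler_pM _ _ h h2) _ => //.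
  rewrite le_eqVlt; apply/orP; left; apply/eqP; rewrite !exprS !expr_div_n.
  have -> : (4 : R) ^+ k = 2 ^+ k * 2 ^+ k by rewrite -exprMn; congr (_ ^+ _); ring.
  by field; rewrite expf_neq0.
rewrite telescope_sumr //.
have : 0 <= 6 * (3 / 4) ^+ N * N%:R :> R by rewrite mulr_ge0 // mulr_ge0 // exprn_ge0 //; lra.
lra.
Qed.

Lemma avoiding_density (R : realType) d (a : 'I_d -> nat) (X : set nat) :
  (forall i, (0 < a i)%N) ->
  (forall k, #|[set q : 'I_(2 ^ k.+1) | [&& 0 < q, trunc_log 2 q == k & `[<X q>]]]%SET|
     * 2 ^ k.+1 <= 3 ^ k.+1)%N ->
  (count_upto (avoiding (coprime_to_all a) X) N)%:R / (count_upto (coprime_to_all a) N)%:R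
          @[N --> \oo] --> (1 : R).
Proof.
move=> a0 HX; apply/cvgrPdist_le => eps e0.
set S := coprime_to_all a; set p := (\prod_i a i)%N.
have p0 : (0 < p)%N by rewrite prodn_gt0.
have pR : (0 : R) < p%:R by rewrite ltr0n.
have [j Hj] : exists j, (3 / 4) ^+ j <= eps / (12 * p%:R) :> R.
  by apply: exp_lt_eps; rewrite ?divr_gt0 ?mulr_gt0 //; lra.
near=> N.
have N0 : (0 < N)%N by near: N; exists 1%N.
have NR : (0 : R) < N%:R by rewrite ltr0n.
have hN : ((2 ^ 2 ^ j)%:R : R) * (2 * p%:R / eps) <= N%:R.
  by near: N; apply: nbhs_infty_ger.
have hs : (N%:R : R) <= (count_upto S N)%:R * p%:R by rewrite -natrM ler_nat count_coprime_lower.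
have hg : (count_upto (avoiding S X) N <= count_upto S N)%N.
  by apply: sub_count => n /set_mem [] /mem_set.
have hb : (count_upto S N)%:R <= (count_upto (avoiding S X) N)%:R +
    ((2 ^ 2 ^ j)%:R + 6 * (3 / 4) ^+ j * N%:R) :> R.
  apply: (le_trans (y := (count_upto (avoiding S X) N + (2 ^ (2 ^ j) +
    \sum_(j <= k < N) #|[set q : 'I_(2 ^ k.+1) |
       [&& 0 < q, trunc_log 2 q == k & `[<X q>]]]%SET| * (N %/ 2 ^ k)))%N%:R)).
    by rewrite ler_nat count_avoiding.
  by rewrite !natrD lerD2l lerD2l (sum_count_levels _ _ _ HX).
move: hs hb; rewrite -(ler_nat R) in hg; move: hg.
move: (count_upto S N)%:R (count_upto (avoiding S X) N)%:R => s g gs hs hb.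
have s0 : 0 < s by rewrite -(pmulr_lgt0 _ pR); apply: lt_le_trans hs.
rewrite ger0_norm; last by rewrite subr_ge0 ler_pdivrMr // mul1r.
have -> : 1 - g / s = (s - g) / s by field; rewrite gt_eqF.
rewrite ler_pdivrMr //.
have h1 : ((2 ^ 2 ^ j)%:R : R) <= eps / (2 * p%:R) * N%:R.
  rewrite mulrAC ler_pdivlMr ?mulr_gt0 //.
  by rewrite mulrA ler_pdivrMr // in hN; rewrite [leRHS]mulrC.
have h2 : 6 * (3 / 4) ^+ j * N%:R <= eps / (2 * p%:R) * N%:R :> R.
  rewrite ler_pM2r //.
  have -> : eps / (2 * p%:R) = 6 * (eps / (12 * p%:R)) by field; rewrite gt_eqF.
  by rewrite ler_pM2l.
have h3 : eps / (2 * p%:R) * N%:R <= eps / 2 * s.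
  have -> : eps / 2 * s = eps / (2 * p%:R) * (s * p%:R) by field; rewrite gt_eqF.
  by rewrite ler_pM2l // divr_gt0 // mulr_gt0.
lra.
Unshelve. all: by end_near.
Qed.

(** * Fourier analysis on the discrete torus *)

Local Open Scope complex_scope.

Definition unit_exp (R : realType) (n : nat) (k : int) : R[i] :=
  let x : R := 2 * pi * k%:~R / n%:R in cos x +i* sin x.

Section UnitExp.
Variables (R : realType) (n : nat).
Hypothesis n0 : (0 < n)%N.
Local Notation e := (@unit_exp R n).

Let nR : (n%:R : R) != 0. Proof. by rewrite pnatr_eq0 -lt0n. Qed.

Lemma unit_expD k l : e (k + l) = e k * e l.
Proof.
rewrite /unit_exp intrD mulrDr mulrDl cosD sinD.
by simpc; congr (_ +i* _); rewrite addrC [sin _ * _]mulrC.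
Qed.

Lemma unit_exp0 : e 0 = 1.
Proof. by rewrite /unit_exp mulr0 mul0r cos0 sin0. Qed.

Lemma unit_exp_sum (I : finType) (p : pred I) (f : I -> int) :
  e (\sum_(i | p i) f i) = \prod_(i | p i) e (f i).
Proof. exact: (big_morph e unit_expD unit_exp0). Qed.

Lemma unit_expM k (m : nat) : e (k * m%:Z) = e k ^+ m.
Proof.
elim: m => [|m IH]; first by rewrite mulr0 unit_exp0 expr0.
by rewrite exprS -IH -unit_expD; congr e; lia.
Qed.

Lemma normc_unit_exp k : normc (e k) = 1.
Proof. by rewrite /unit_exp /normc /= cos2Dsin2 sqrtr1. Qed.

Lemma unit_exp_period m : e (n%:Z * m) = 1.
Proof.
have e1 : e n%:Z = 1.
  rewrite /unit_exp.
  have -> : 2 * pi * n%:~R / n%:R = pi *+ 2 :> R.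
    by rewrite -mulrA -[n%:~R]/(n%:R) divff // mulr1 mulr_natl.
  by rewrite cos2pi sin2pi.
case: m => m; first by rewrite unit_expM e1 expr1n.
rewrite NegzE; have := unit_expD (n%:Z * - m.+1%:Z) (n%:Z * m.+1%:Z).
rewrite mulrN addNr unit_exp0 unit_expM e1 expr1n mulr1 => <- //.
Qed.

Lemma unit_exp_cong k l : (n%:Z %| k - l)%Z -> e k = e l.
Proof.
move=> /dvdzP[m E]; have -> : k = l + n%:Z * m by rewrite mulrC -E; ring.
by rewrite unit_expD unit_exp_period mulr1.
Qed.

Lemma Re_unit_exp k : complex.Re (e k) = cos (2 * pi * `|cent n k|%:~R / n%:R).
Proof.
have -> : e k = e (cent n k).
  by apply: unit_exp_cong; rewrite /cent opprB addrC subrK dvdz_mulr.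
rewrite /unit_exp /= -cos_norm !normrM normfV !normr_nat -intr_norm.
by rewrite ger0_norm ?pi_ge0.
Qed.

Lemma cent_angle k : 2 * pi * `|cent n k|%:~R / n%:R \in `[0, pi : R].
Proof.
have n0R : (0 : R) < n%:R by rewrite ltr0n.
have := cent_bound k n0; rewrite -(ler_int R) intrM => h.
have c0 : (0 : R) <= `|cent n k|%:~R by rewrite ler0z.
have p0 := pi_gt0 R.
rewrite in_itv /=; apply/andP; split.
  by rewrite !mulr_ge0 // ?ltW // invr_gt0.
rewrite ler_pdivrMr // mulrAC [_ * pi]mulrC ler_pM2l //.
Qed.

(** The cosine decreases on [0, pi], where the angle of the centred representative lies. *)
Lemma Re_unit_exp_far (eps : R) k : 0 <= eps ->
  (forall m, eps * n%:R < `|k - n%:Z * m|%:~R) -> complex.Re (e k) <= cos (2 * pi * eps).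
Proof.
move=> e0 H; rewrite Re_unit_exp.
have n0R : (0 : R) < n%:R by rewrite ltr0n.
have p0 := pi_gt0 R.
have hE : 2 * pi * eps < 2 * pi * `|cent n k|%:~R / n%:R.
  rewrite -[ltRHS]mulrA ltr_pM2l ?mulr_gt0 //.
  by rewrite ltr_pdivlMr //; apply: H.
have := cent_angle k; rewrite in_itv /= => /andP[h1 h2].
apply: ltW; rewrite ltr_cos ?cent_angle //.
rewrite in_itv /= !mulr_ge0 // ?ltW // (lt_le_trans hE) //.
Qed.

Lemma unit_exp_neq1 k : ~ (n%:Z %| k)%Z -> e k != 1.
Proof.
move=> nk; apply/eqP => E.
have := Re_unit_exp k; rewrite E /=.
have : cent n k != 0.
  by apply/eqP => c0; apply: nk; move/eqP: c0; rewrite subr_eq0 => /eqP ->; rewrite dvdz_mulr.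
rewrite -normr_gt0 -(ltr_int R) => c0.
have : cos (2 * pi * `|cent n k|%:~R / n%:R) < cos 0 :> R.
  rewrite ltr_cos ?cent_angle ?in_itv /= ?lexx ?pi_ge0 //.
  by rewrite divr_gt0 ?ltr0n // !mulr_gt0 // ?pi_gt0.
by rewrite cos0 => h h'; move: h; rewrite -h' ltxx.
Qed.

(** A geometric sum. *)
Lemma sum_unit_exp m : \sum_(k < n.-1.+1) e (k%:Z * m) = if (n%:Z %| m)%Z then n%:R else 0.
Proof.
rewrite prednK //; case: ifPn => [/dvdzP[l ->]|nm].
  rewrite (eq_bigr (fun=> 1)); first by rewrite sumr_const card_ord.
  by move=> k _; rewrite mulrA mulrC unit_exp_period.
have z1 : e m - 1 != 0 by rewrite subr_eq0 unit_exp_neq1 //; apply/negP.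
apply: (mulfI z1); rewrite mulr0.
rewrite (eq_bigr (fun k : 'I_n => e m ^+ k)); last by move=> k _; rewrite -unit_expM mulrC.
by rewrite -subrX1 -unit_expM mulrC unit_exp_period subrr.
Qed.

End UnitExp.

Definition int_row (m d : nat) (xi : {ffun 'I_d -> 'I_m}) : 'rV[int]_d :=
  \row_j (xi j : nat)%:Z.

Definition fourier (R : realType) (n d : nat) (f : torus n d -> R) (xi : 'rV[int]_d) : R[i] :=
  \sum_z (f z)%:C * unit_exp R n ((xi *m lift_torus z) 0 0).

Lemma normc_ge0 (R : realType) (x : R[i]) : 0 <= normc x.
Proof. exact: (@normr_ge0 _ (Rcomplex R)). Qed.

Lemma normc_sum (R : realType) (I : finType) (p : pred I) (f : I -> R[i]) :
  normc (\sum_(i | p i) f i) <= \sum_(i | p i) normc (f i).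
Proof. exact: (@ler_norm_sum _ (Rcomplex R)). Qed.

Lemma normc_prod (R : realType) (I : finType) (p : pred I) (f : I -> R[i]) :
  normc (\prod_(i | p i) f i) = \prod_(i | p i) normc (f i).
Proof.
exact: (big_morph _ (@ComplexField.Normc.normcM R) (@ComplexField.Normc.normc1 R)).
Qed.

Lemma normc_real (R : realType) (x : R) : normc x%:C = `|x|.
Proof. by rewrite /normc /= expr0n /= addr0 sqrtr_sqr. Qed.

Section Torus.
Variables (R : realType) (n d : nat).
Hypothesis n0 : (0 < n)%N.
Local Notation e := (@unit_exp R n).
Implicit Types (v w : 'cV[int]_d) (x y z : torus n d) (xi : 'rV[int]_d).

Let nP : n.-1.+1 = n. Proof. exact: prednK. Qed.

Lemma lift_reduce v i : lift_torus (reduce n v) i 0 = ((v i 0)%R %% n%:Z)%Z.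
Proof.
rewrite !mxE inordK.
  by rewrite gez0_abs // modz_ge0 //; lia.
have h1 := @modz_ge0 (v i 0) n%:Z ltac:(lia).
have h2 := @ltz_pmod (v i 0) n%:Z ltac:(lia).
by rewrite nP -ltz_nat gez0_abs.
Qed.

Lemma reduce_cong v w : (forall i, (n%:Z %| (v i 0 - w i 0)%R)%Z) -> reduce n v = reduce n w.
Proof.
move=> H; apply/colP => i; rewrite !mxE; congr (inord (absz _)).
by apply/eqP; rewrite eqz_mod_dvd.
Qed.

Lemma reduce_lift x : reduce n (lift_torus x) = x.
Proof.
apply/colP => i; rewrite !mxE modz_nat absz_nat modn_small ?inord_val //.
by rewrite -[X in (_ < X)%N]nP.
Qed.

Lemma dvd_lift_reduce v i : (n%:Z %| (lift_torus (reduce n v) i 0 - v i 0)%R)%Z.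
Proof. by rewrite lift_reduce -eqz_mod_dvd modz_mod. Qed.

Lemma unit_exp_mul_cong xi v w : (forall i, (n%:Z %| (v i 0 - w i 0)%R)%Z) ->
  e ((xi *m v) 0 0) = e ((xi *m w) 0 0).
Proof.
move=> H; apply: unit_exp_cong => //; rewrite !mxE -sumrB.
by apply: rpred_sum => i _; rewrite -mulrBr dvdz_mull.
Qed.

Lemma unit_exp_reduce xi v : e ((xi *m lift_torus (reduce n v)) 0 0) = e ((xi *m v) 0 0).
Proof. by apply: unit_exp_mul_cong; apply: dvd_lift_reduce. Qed.

Lemma sum_characters v :
  \sum_(xi : {ffun 'I_d -> 'I_n.-1.+1}) e ((int_row xi *m v) 0 0) =
  if [forall i, (n%:Z %| (v i 0)%R)%Z] then (n ^ d)%N%:R else 0.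
Proof.
transitivity (\sum_(xi : {ffun 'I_d -> 'I_n.-1.+1}) \prod_i e ((xi i : nat)%:Z * v i 0)).
  apply: eq_bigr => xi _; rewrite mxE unit_exp_sum.
  by apply: eq_bigr => i _; rewrite mxE.
rewrite -(bigA_distr_bigA (fun i (k : 'I_n.-1.+1) => e ((k : nat)%:Z * v i 0))).
under eq_bigr do rewrite sum_unit_exp //.
case: ifPn => [/forallP H|].
  by rewrite (eq_bigr (fun=> n%:R)) ?prodr_const ?card_ord ?natrX // => i _; rewrite H.
rewrite negb_forall => /existsP[i /negbTE Hi].
by rewrite (bigD1 i) //= Hi mul0r.
Qed.

Lemma fourier_inversion (f : torus n d -> R) x :
  ((n ^ d)%N%:R * f x)%:C =
  \sum_(xi : {ffun 'I_d -> 'I_n.-1.+1})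
     fourier f (int_row xi) * e (- (int_row xi *m lift_torus x) 0 0).
Proof.
transitivity (\sum_z (f z)%:C * \sum_(xi : {ffun 'I_d -> 'I_n.-1.+1})
    e ((int_row xi *m (lift_torus z - lift_torus x)) 0 0)).
  rewrite (bigD1 x) //= [X in _ + X]big1 ?addr0; last first.
    move=> z zx; rewrite sum_characters; case: ifPn => [/forallP H|]; last by rewrite mulr0.
    case/eqP: zx; rewrite -[z]reduce_lift -[x]reduce_lift; apply: reduce_cong => i.
    by have := H i; rewrite !mxE.
  rewrite sum_characters ifT; last by apply/forallP => i; rewrite subrr mxE.
  by rewrite rmorphM rmorph_nat mulrC.
under eq_bigr do rewrite mulr_sumr.
rewrite exchange_big; apply: eq_bigr => xi _; rewrite mulr_suml; apply: eq_bigr => z _.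
rewrite -mulrA -unit_expD; congr (_ * e _).
by rewrite mulmxBr [LHS]mxE [X in _ + X = _]mxE.
Qed.

Lemma fourier0 (f : torus n d -> R) : fourier f 0 = (\sum_z f z)%:C.
Proof.
rewrite rmorph_sum; apply: eq_bigr => z _.
by rewrite mul0mx mxE unit_exp0 mulr1.
Qed.

Lemma card_torus : #|{: torus n d}| = (n ^ d)%N.
Proof. by rewrite card_mx card_ord nP muln1. Qed.

(** The l^1 norm of f - U is bounded by |X| times its sup norm, and Fourier inversion
    bounds the latter termwise. *)
Lemma tv_fourier (f : torus n d -> R) : \sum_z f z = 1 ->
  tv f (@uniform_pmf R (torus n d)) <=
  \sum_(xi : {ffun 'I_d -> 'I_n.-1.+1} | int_row xi != 0) normc (fourier f (int_row xi)).
Proof.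
move=> f1; set B := \sum_(_ | _) _.
have N0 : (0 : R) < (n ^ d)%N%:R by rewrite ltr0n expn_gt0 n0.
have B0 : 0 <= B by apply: sumr_ge0 => xi _; exact: normc_ge0.
have H z : `|f z - (n ^ d)%N%:R^-1| <= B / (n ^ d)%N%:R.
  rewrite ler_pdivlMr // -[X in _ * X](ger0_norm (ltW N0)) -normrM mulrBl mulVf ?gt_eqF //.
  rewrite mulrC -normc_real.
  have -> : ((n ^ d)%N%:R * f z - 1)%:C = ((n ^ d)%N%:R * f z)%:C - 1.
    by rewrite rmorphB.
  rewrite fourier_inversion.
  pose xi0 : {ffun 'I_d -> 'I_n.-1.+1} := [ffun=> ord0].
  have E0 : int_row xi0 = 0 by apply/rowP => j; rewrite !mxE ffunE.
  have Exi (k : {ffun 'I_d -> 'I_n.-1.+1}) : (int_row k != 0) = (k != xi0).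
    apply/idP/idP; apply: contra => /eqP; first by move=> ->; rewrite E0.
    move=> h; apply/eqP/ffunP => j; rewrite ffunE; apply: val_inj => /=.
    have /(congr1 (fun u : 'rV_d => u 0 j)) := h.
    by rewrite !mxE => -[].
  rewrite (bigD1 xi0) //= E0 fourier0 f1 mul0mx mxE oppr0 unit_exp0 mulr1.
  have E1 (x : R[i]) : 1%:C + x - 1 = x by rewrite (_ : 1%:C = 1) // addrC addKr.
  rewrite E1.
  apply: le_trans (normc_sum _ _) _; rewrite /B (eq_bigl _ _ Exi).
  by apply: ler_sum => xi _; rewrite ComplexField.Normc.normcM normc_unit_exp mulr1.
rewrite /tv /uniform_pmf card_torus.
apply: le_trans (_ : 2%:R^-1 * (\sum_(z : torus n d) B / (n ^ d)%N%:R) <= _).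
  by rewrite ler_pM2l ?invr_gt0 //; apply: ler_sum => z _; apply: H.
rewrite sumr_const card_torus -(mulr_natr (B / _)) divfK ?gt_eqF //.
by rewrite ler_piMl // invf_le1 // ler1n.
Qed.

End Torus.

(** * The law of the walk *)

Lemma fine_measure_finite_union dT (T : measurableType dT) (R : realType) (P : probability T R)
  (I : finType) (p : pred I) (F : I -> set T) :
  (forall i, measurable (F i)) -> trivIset setT F ->
  fine (P (\bigcup_(i in [set i | p i]) F i)) = \sum_(i | p i) fine (P (F i)).
Proof.
move=> mF tF; rewrite measure_fin_bigcup //=; last exact: sub_trivIset tF.
have -> : [set i | p i] = [set` p] by [].
rewrite -(@bigfs _ _ _ _ (index_enum I)) ?index_enum_uniq //; last first.
  by move=> i _; rewrite mem_index_enum.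
by rewrite -sum_fine // => i _; rewrite fin_num_measure.
Qed.

Lemma prod_EFin (R : realType) (s : seq nat) (f : nat -> \bar R) :
  (forall i, f i \is a fin_num) -> (\prod_(i <- s) f i)%E = (\prod_(i <- s) fine (f i))%:E.
Proof.
move=> Hf; elim: s => [|i s IH]; first by rewrite !big_nil.
by rewrite !big_cons EFinM IH fineK.
Qed.

Section Walk.
Variables (R : realType) (n d : nat) (A : 'M[int]_d).
Hypothesis n0 : (0 < n)%N.
Local Notation e := (@unit_exp R n).

(** Unrolls X_t = sum of A^(t-s) B_s inside a character. *)
Lemma unit_exp_walk b t (xi : 'rV[int]_d) :
  e ((xi *m lift_torus (walk n A b t)) 0 0) =
  \prod_(s < t) e ((xi *m A ^+ (t - s.+1) *m b s.+1) 0 0).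
Proof.
elim: t xi => [|t IH] xi /=.
  by rewrite big_ord0 unit_exp_reduce // mulmx0 mxE unit_exp0.
rewrite unit_exp_reduce // mulmxDr [X in e X]mxE unit_expD big_ord_recr /= subnn expr0 mulmx1.
congr (_ * _); rewrite mulmxA IH; apply: eq_bigr => s _.
by rewrite /= subSS -(subnSK (ltn_ord s)) exprS mulmxA.
Qed.

Lemma walk_cong b b' t :
  (forall s, (s < t)%N -> reduce n (b s.+1) = reduce n (b' s.+1)) ->
  walk n A b t = walk n A b' t.
Proof.
elim: t => [//|t IH] H /=; rewrite IH; last by move=> s st; apply: H; apply: ltnW.
apply: reduce_cong => i; rewrite !mxE opprD addrACA subrr add0r -eqz_mod_dvd.
apply/eqP; have := congr1 (fun x => lift_torus x i 0) (H t (ltnSn t)).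
by rewrite !lift_reduce.
Qed.

(** The increments read off from a word of t residues, indexed from 1 as in the walk. *)
Definition spread t (z : {ffun 'I_t -> torus n d}) (k : nat) : 'cV[int]_d :=
  if insub k.-1 is Some s then lift_torus (z s) else 0.

Lemma spreadE t (z : {ffun 'I_t -> torus n d}) (s : 'I_t) : spread z s.+1 = lift_torus (z s).
Proof.
rewrite /spread /=; case: insubP => [s' _ h|]; first by congr (lift_torus (z _)); apply: val_inj.
by rewrite ltn_ord.
Qed.

Variables (mu : probability 'cV[int]_d R).
Variables (dO : measure_display) (O : measurableType dO) (P : probability O R).
Variables (B : nat -> {RV P >-> 'cV[int]_d}).
Hypothesis hB : iid (fun t => B t.+1) mu.

Definition step_pmf (z : torus n d) : R := fine (mu (@reduce n d @^-1` [set z])).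

Lemma step_pmf_ge0 z : 0 <= step_pmf z.
Proof. exact: fine_ge0. Qed.

Lemma sum_step_pmf : \sum_z step_pmf z = 1.
Proof.
rewrite -(fine_measure_finite_union mu) //; last first.
  by move=> i j _ _ [x [/= <- <-]].
rewrite (_ : \bigcup_(_ in _) _ = setT) ?probability_setT //.
by apply/seteqP; split => // x _; exists (reduce n x).
Qed.

Definition steps_event t (z : {ffun 'I_t -> torus n d}) : set O :=
  [set w | forall s : 'I_t, reduce n (B s.+1 w) = z s].

Lemma steps_eventE t (z : {ffun 'I_t -> torus n d}) :
  steps_event z = \bigcap_(i in [set` seq_fset tt (iota 0 t)])
    (B i.+1 @^-1` (@reduce n d @^-1` [set reduce n (spread z i.+1)])).
Proof.
have HJ i : (i \in seq_fset tt (iota 0 t)) = (i < t)%N by rewrite seq_fsetE mem_iota add0n.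
move: (seq_fset _ _) HJ => J HJ; apply/seteqP; split => w H.
  move=> i /= hi; have it : (i < t)%N by rewrite -HJ.
  by have := H (Ordinal it); rewrite (spreadE z (Ordinal it)) reduce_lift.
move=> s; have hs : [set` J] (s : nat) by rewrite /= HJ.
by have := H s hs; rewrite /= spreadE reduce_lift.
Qed.

Lemma measurable_steps_event t (z : {ffun 'I_t -> torus n d}) : measurable (steps_event z).
Proof.
rewrite steps_eventE; apply: fin_bigcap_measurable => // i _.
exact: measurable_funPTI.
Qed.

Lemma prob_steps_event t (z : {ffun 'I_t -> torus n d}) :
  fine (P (steps_event z)) = \prod_(s < t) step_pmf (z s).
Proof.
rewrite steps_eventE hB.1 //.
rewrite (eq_bigr (fun i => mu (@reduce n d @^-1` [set reduce n (spread z i.+1)]))); last first.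
  by move=> i _; rewrite -(hB.2 i).
rewrite prod_EFin; last by move=> i; rewrite fin_num_measure.
rewrite /= (perm_big _ (seq_fset_perm tt (iota 0 t))) undup_id ?iota_uniq //=.
rewrite -[t in iota 0 t]subn0 -[iota 0 _]/(index_iota 0 t) big_mkord.
by apply: eq_bigr => s _; rewrite spreadE reduce_lift.
Qed.

(** The walk depends only on the residues of its first t increments, whose joint law is a
    product by independence. *)
Lemma law_walk t x :
  law_pmf P (fun w => walk n A (fun s => B s w) t) x =
  \sum_(z : {ffun 'I_t -> torus n d} | walk n A (spread z) t == x) \prod_(s < t) step_pmf (z s).
Proof.
under eq_bigr do rewrite -prob_steps_event.
rewrite -fine_measure_finite_union; first last.
- move=> z z' _ _ [w [/= h h']]; apply/ffunP => s; by rewrite -h -h'.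
- exact: measurable_steps_event.
rewrite /law_pmf; congr (fine (P _)); apply/seteqP; split => w /=.
  move=> <-; exists [ffun s : 'I_t => reduce n (B s.+1 w)].
    apply/eqP/walk_cong => s st.
    by rewrite (spreadE _ (Ordinal st)) reduce_lift // ffunE.
  by move=> s; rewrite ffunE.
move=> [z /eqP <- H]; apply: walk_cong => s st.
by rewrite (spreadE _ (Ordinal st)) reduce_lift // -(H (Ordinal st)).
Qed.

Lemma fourier_walk t (xi : 'rV[int]_d) :
  fourier (law_pmf P (fun w => walk n A (fun s => B s w) t)) xi =
  \prod_(s < t) fourier step_pmf (xi *m A ^+ s).
Proof.
rewrite /fourier; under eq_bigr => x _ do rewrite law_walk rmorph_sum mulr_suml.
rewrite (reindex_inj rev_ord_inj) /=.
rewrite bigA_distr_bigA /=.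
rewrite [RHS](partition_big (fun z => walk n A (spread z) t) predT) //=.
apply: eq_bigr => x _; apply: eq_bigr => z /eqP <-.
rewrite unit_exp_walk rmorph_prod -big_split /=; apply: eq_bigr => s _.
by rewrite spreadE.
Qed.

Lemma sum_law_walk t : \sum_x law_pmf P (fun w => walk n A (fun s => B s w) t) x = 1.
Proof.
have := fourier_walk t 0; rewrite fourier0.
rewrite [X in _ = X]big1; first by move=> /(congr1 (@complex.Re R)).
by move=> s _; rewrite mul0mx fourier0 sum_step_pmf.
Qed.

End Walk.

(** * Frequencies where the step law has a large Fourier coefficient *)

(** The law of cosines: |a + b e^(i x)|^2 = (a + b)^2 - 2 a b (1 - cos x), where a + b <= 1
    allows to take the square root crudely. *)
Lemma normc_two (R : realType) (n : nat) (n0 : (0 < n)%N) (a b c : R) (k l : int) :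
  0 <= a -> 0 <= b -> a + b <= 1 -> complex.Re (unit_exp R n (k - l)) <= c -> -1 <= c -> c <= 1 ->
  normc (a%:C * unit_exp R n k + b%:C * unit_exp R n l) <= a + b - a * b * (1 - c).
Proof.
move=> a0 b0 ab hc c1 c2; have -> : k = (k - l) + l by ring.
rewrite unit_expD // mulrA -mulrDl ComplexField.Normc.normcM normc_unit_exp mulr1.
move: hc; rewrite /unit_exp /=; set x := _ / _ => hc.
have cs := cos2Dsin2 x; move: cs hc; move: (cos x) (sin x) => u v cs hc.
have h0 : 0 <= a + b - a * b * (1 - c).
  have : a * b <= a by rewrite ler_piMr //; lra.
  have : a * b <= b by rewrite ler_piMl //; lra.
  have : 0 <= a * b by apply: mulr_ge0.
  nra.
simpc; rewrite /normc -[leRHS](ger0_norm h0) -sqrtr_sqr ler_sqrt ?sqr_ge0 //.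
have -> : (a * u + b) ^+ 2 + (a * v) ^+ 2 = (a + b) ^+ 2 - 2 * (a * b) * (1 - u).
  have -> : (a * u + b) ^+ 2 + (a * v) ^+ 2 =
      a ^+ 2 * (u ^+ 2 + v ^+ 2) + 2 * a * b * u + b ^+ 2 by ring.
  by rewrite cs; ring.
have p0 : 0 <= a * b by apply: mulr_ge0.
have -> : (a + b - a * b * (1 - c)) ^+ 2 =
  (a + b) ^+ 2 - 2 * (a + b) * (a * b * (1 - c)) + (a * b * (1 - c)) ^+ 2 by ring.
have := sqr_ge0 (a * b * (1 - c)); set y := _ ^+ 2.
have h1 : a * b * (1 - c) <= a * b * (1 - u) by rewrite ler_wpM2l // lerD2l lerN2.
have h2 : (a + b) * (a * b * (1 - c)) <= a * b * (1 - c).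
  by rewrite ler_piMl // mulr_ge0 // subr_ge0.
lra.
Qed.

Section StepDecay.
Variables (R : realType) (d : nat) (A : 'M[int]_d.+1) (mu : probability 'cV[int]_d.+1 R).

(** Frequencies whose step transform stays near modulus 1 for J steps almost annihilate v.
    That rho does not depend on n is what makes the final constant C independent of n. *)
Definition controlled (v : 'cV[int]_d.+1) := exists J : nat, forall eps : R, 0 < eps ->
  exists2 rho : R, 0 <= rho < 1 & forall (n : nat) (xi : 'rV[int]_d.+1), (0 < n)%N ->
    (forall j, (j < J)%N -> rho < normc (fourier (@step_pmf R n d.+1 mu) (xi *m A ^+ j))) ->
    exists m, `|(xi *m v) 0 0 - n%:Z * m|%:~R <= eps * n%:R.

Lemma step_pmf_reduce n b : fine (mu [set b]) <= @step_pmf R n d.+1 mu (reduce n b).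
Proof.
rewrite /step_pmf fine_le ?fin_num_measure // le_measure ?inE //.
by move=> x ->.
Qed.

(** Two atoms of the step law at b and b' whose phases differ force a cancellation in the
    transform. *)
Lemma controlled_difference b b' : supp mu b -> supp mu b' -> controlled (b - b').
Proof.
move=> sb sb'; exists 1%N => eps e0.
have pos x : supp mu x -> 0 < fine (mu [set x]).
  by move=> sx; rewrite fine_gt0 // sx /= ltey_eq fin_num_measure.
have le1 x : fine (mu [set x]) <= 1.
  by rewrite -lee_fin fineK ?fin_num_measure // probability_le1.
have p0 := pos b sb; have p0' := pos b' sb'; have p1 := le1 b; have p1' := le1 b'.
move: p0 p0' p1 p1'; set p := fine _; set p' := fine _ => p0 p0' p1 p1'.
pose eps' := Num.min eps (1 / 4).
have e'0 : 0 < eps' by rewrite lt_min e0; lra.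
have e'1 : eps' <= 1 / 4 by rewrite ge_min lexx orbT.
set c := cos (2 * pi * eps').
have c1 : c < 1.
  rewrite -cos0 ltr_cos ?in_itv /= ?lexx ?pi_ge0 //.
    by rewrite !mulr_gt0 ?pi_gt0.
  rewrite !mulr_ge0 ?pi_ge0 ?ltW //=.
  have := pi_gt0 R; nra.
have cN1 : -1 <= c by exact: cos_geN1.
(* Halving the gain keeps this bound nonnegative. *)
exists (1 - p * p' * (1 - c) / 2).
  have : 0 < p * p' by apply: mulr_gt0.
  have : p * p' <= 1 by rewrite mulr_ile1 // ltW.
  move: (p * p') => y y1 y0; apply/andP; split; nra.
move=> n xi n0 /(_ 0%N isT); rewrite expr0 mulmx1 => H.
apply: contrapT => nex.
have Ed : (xi *m (b - b')) 0 0 = (xi *m b) 0 0 - (xi *m b') 0 0.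
  by rewrite mulmxBr [LHS]mxE [X in _ + X = _]mxE.
have far m : eps' * n%:R < `|(xi *m (b - b')) 0 0 - n%:Z * m|%:~R.
  rewrite ltNge; apply/negP => h; apply: nex; exists m; apply: le_trans h _.
  by rewrite ler_wpM2r // ge_min lexx.
have hc := Re_unit_exp_far n0 (ltW e'0) far.
have zz : reduce n b != reduce n b'.
  apply/eqP => E.
  have E2 : unit_exp R n ((xi *m (b - b')) 0 0) = 1.
    have en0 : unit_exp R n ((xi *m b') 0 0) != 0.
      apply/eqP => h; have := normc_unit_exp R n ((xi *m b') 0 0).
      by rewrite h ComplexField.Normc.normc0 => /esym/eqP; rewrite oner_eq0.
    apply: (mulIf en0); rewrite mul1r -unit_expD // Ed subrK.
    by rewrite -(unit_exp_reduce R n0 xi b) E unit_exp_reduce.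
  by move: hc; rewrite E2 /= leNgt => /negP; apply.
move: H; rewrite ltNge => /negP; apply.
rewrite /fourier (bigD1 (reduce n b)) //= (bigD1 (reduce n b')) /=; last by rewrite eq_sym.
set q := step_pmf mu (reduce n b); set q' := step_pmf mu (reduce n b').
rewrite !unit_exp_reduce // addrA.
apply: le_trans (le_normcD _ _) _.
have S := sum_step_pmf n mu.
rewrite (bigD1 (reduce n b)) //= (bigD1 (reduce n b')) /= in S; last by rewrite eq_sym.
have hs : normc (\sum_(i | (i != reduce n b) && (i != reduce n b'))
    (step_pmf mu i)%:C * unit_exp R n ((xi *m lift_torus i) 0 0)) <=
   \sum_(i | (i != reduce n b) && (i != reduce n b')) step_pmf mu i.
  apply: le_trans (normc_sum _ _) _; apply: ler_sum => i _.
  by rewrite ComplexField.Normc.normcM normc_unit_exp mulr1 normc_real ger0_norm // step_pmf_ge0.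
have s0 : 0 <= \sum_(i | (i != reduce n b) && (i != reduce n b')) step_pmf mu i.
  by apply: sumr_ge0 => i _; exact: step_pmf_ge0.
move: hs S s0; rewrite -/q -/q'; set rest := \sum_(_ | _) step_pmf mu _ => hs S s0.
have hq : p <= q by apply: step_pmf_reduce.
have hq' : p' <= q' by apply: step_pmf_reduce.
have h2 : normc (q%:C * unit_exp R n ((xi *m b) 0 0) + q'%:C * unit_exp R n ((xi *m b') 0 0))
    <= q + q' - q * q' * (1 - c).
  apply: normc_two => //; try lra.
  by rewrite -Ed.
have h3 : p * p' <= q * q' by apply: ler_pM => //; apply: ltW.
have h4 : p * p' * (1 - c) <= q * q' * (1 - c) by rewrite ler_wpM2r //; lra.
have h5 : 0 <= p * p' * (1 - c) by rewrite !mulr_ge0 //; lra.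
lra.
Qed.

End StepDecay.

Section Lattice.
Variables (R : realType) (d : nat) (A : 'M[int]_d.+1) (mu : probability 'cV[int]_d.+1 R).

(** The controlled vectors form a subgroup, and A v costs one more step than v since
    xi (A v) = (xi A) v; so they contain the smallest invariant subgroup. *)
Lemma controlled_step_subgroup v : step_subgroup mu A v -> controlled A mu v.
Proof.
move=> /(_ (controlled A mu)); apply; split; last first.
  by move=> _ [x sx [y sy <-]]; apply: controlled_difference.
split; first split.
- exists 0%N => eps e0; exists 0; first by rewrite lexx ltr01.
  move=> n xi n0 _; exists 0.
  by rewrite mulmx0 mxE mulr0 subr0 normr0 mulr_ge0 // ltW.
- move=> x y [J HJ] [J' HJ']; exists (maxn J J') => eps e0.
  have e2 : 0 < eps / 2 by lra.
  have [r /andP[r0 r1] Hr] := HJ _ e2; have [r' /andP[r0' r1'] Hr'] := HJ' _ e2.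
  exists (Num.max r r'); first by rewrite le_max r0 gt_max r1.
  move=> n xi n0 H.
  have hr : r <= Num.max r r' by rewrite le_max lexx.
  have hr' : r' <= Num.max r r' by rewrite le_max lexx orbT.
  have [m Hm] := Hr n xi n0 (fun j hj => le_lt_trans hr (H j (leq_trans hj (leq_maxl _ _)))).
  have [m' Hm'] := Hr' n xi n0 (fun j hj => le_lt_trans hr' (H j (leq_trans hj (leq_maxr _ _)))).
  exists (m - m').
  rewrite mulmxBr mxE [X in _ + X - _]mxE.
  move: Hm Hm'; move: ((xi *m x) 0 0) ((xi *m y) 0 0) => k k' Hm Hm'.
  have -> : k - k' - n%:Z * (m - m') = (k - n%:Z * m) - (k' - n%:Z * m') by ring.
  apply: (@le_trans _ _ ((`|k - n%:Z * m| + `|k' - n%:Z * m'|)%:~R)).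
    by rewrite ler_int ler_normB.
  rewrite intrD; lra.
move=> x [J HJ]; exists J.+1 => eps e0.
have [r r01 Hr] := HJ _ e0; exists r => // n xi n0 H.
rewrite mulmxA; apply: Hr => // j hj.
by rewrite -mulmxA mulmxE -exprS; apply: H.
Qed.

Lemma generated_span (I : finType) (h : I -> 'cV[int]_d.+1) x :
  generated (range h) x -> exists c : I -> int, x = \sum_i h i *~ c i.
Proof.
move=> /(_ [set x | exists c : I -> int, x = \sum_i h i *~ c i]); apply; split; last first.
  move=> _ [i _ <-]; exists (fun j => (j == i)%:R).
  rewrite (bigD1 i) //= eqxx mulr1z big1 ?addr0 // => j /negbTE ->.
  by rewrite mulr0z.
split; first by exists (fun=> 0); rewrite big1 // => i _; rewrite mulr0z.
move=> _ _ [c ->] [c' ->]; exists (fun i => c i - c' i).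
by rewrite -sumrB; apply: eq_bigr => i _; rewrite mulrzBr.
Qed.

Lemma subset_generated (V : zmodType) (S : set V) : S `<=` generated S.
Proof. by move=> x Sx G [_]; apply. Qed.

Lemma step_subgroup_invariant x : step_subgroup mu A x -> step_subgroup mu A (A *m x).
Proof. by move=> Hx G HG; apply: HG.1.2; apply: Hx. Qed.

Variables (u : 'I_d.+1 -> 'cV[int]_d.+1) (hu : Z_basis u).
Variables (a : 'I_d.+1 -> nat) (ha : forall i, (0 < a i)%N).
Hypothesis hgen : step_subgroup mu A = generated (range (fun i => u i *+ a i)).
Hypothesis uA : A \in unitmx.
Hypothesis hypA : hyperbolic R A.

Definition step_matrix : 'M[int]_d.+1 := \matrix_(i, j) (u j i 0 *+ a j).

Lemma col_step_matrix j : col j step_matrix = u j *+ a j.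
Proof.
apply/colP => i; rewrite !mxE.
by elim: (a j) => [|k IH]; rewrite ?mulr0n ?mxE // !mulrS mxE IH.
Qed.

Lemma step_matrix_in j : step_subgroup mu A (col j step_matrix).
Proof.
rewrite hgen; apply: subset_generated; exists j => //.
by rewrite col_step_matrix.
Qed.

(** A generating family of d vectors has an invertible matrix: V lists the coordinates of
    the standard basis. *)
Lemma basis_unit : exists2 V : 'M[int]_d.+1,
  (\matrix_(i, j) u j i 0) *m V = 1%:M & step_matrix =
  (\matrix_(i, j) u j i 0) *m diag_mx (\row_j (a j)%:Z).
Proof.
have H (j : 'I_d.+1) : exists c : 'I_d.+1 -> int, delta_mx j 0 = \sum_i u i *~ c i.
  by apply: generated_span; rewrite hu.
have [c Hc] := boolp.choice H.
exists (\matrix_(k, j) c j k).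
  apply/matrixP => i j; have := congr1 (fun x : 'cV_d.+1 => x i 0) (Hc j).
  rewrite !mxE summxE eqxx andbT => ->; apply: eq_bigr => k _.
  by rewrite !mxE -scaler_int mxE intz mulrC.
apply/matrixP => i j; rewrite mul_mx_diag !mxE.
by rewrite -natz mulr_natr.
Qed.

Lemma coprime_divides n (xi : 'rV[int]_d.+1) : coprime_to_all a n ->
  (exists w, xi *m step_matrix = n%:Z *: w) -> exists w, xi = n%:Z *: w.
Proof.
move=> [n0 cop] [w E]; have [V UV EM] := basis_unit.
set U := \matrix_(i, j) u j i 0 in UV EM.
have H j : (n%:Z %| (xi *m U) 0%R j)%Z.
  have Ej : (xi *m U) 0 j * (a j)%:Z = n%:Z * w 0 j.
    have := congr1 (fun x : 'rV_d.+1 => x 0 j) E.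
    by rewrite EM mulmxA mul_mx_diag [LHS]mxE [RHS]mxE [X in _ * X = _]mxE.
  by rewrite -(@Gauss_dvdzl _ _ (a j)%:Z) ?Ej ?dvdz_mulr // coprimezE; apply: cop.
exists ((\row_j ((xi *m U) 0%R j %/ n%:Z)%Z) *m V).
rewrite scalemxAl -[LHS]mulmx1 -UV mulmxA; congr (_ *m _).
by apply/rowP => j; rewrite [RHS]mxE [X in _ = _ * X]mxE [RHS]mulrC divzK.
Qed.

Lemma det_step_matrix : \det step_matrix != 0.
Proof.
have [V UV ->] := basis_unit; rewrite det_mulmx det_diag mulf_neq0 //.
  have := congr1 determinant UV; rewrite det_mulmx det1 => h.
  by apply/eqP => h0; move: h; rewrite h0 mul0r.
by apply/prodf_neq0 => i _; rewrite mxE; have := ha i; lia.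
Qed.

(** The columns of [step_matrix] generate the A-invariant subgroup H, so A acts on it by an
    integer matrix; [step_matrix] is invertible over the rationals, so spectrum and
    determinant are those of A. *)
Lemma conjugate_matrix : exists A' : 'M[int]_d.+1,
  [/\ A *m step_matrix = step_matrix *m A', A' \in unitmx & hyperbolic R A'].
Proof.
have H (j : 'I_d.+1) : exists c : 'I_d.+1 -> int,
    A *m col j step_matrix = \sum_i (u i *+ a i) *~ c i.
  apply: (@generated_span _ (fun i => u i *+ a i)); rewrite -hgen.
  by apply: step_subgroup_invariant; apply: step_matrix_in.
have [c Hc] := boolp.choice H.
exists (\matrix_(k, j) c j k).
have E : A *m step_matrix = step_matrix *m \matrix_(k, j) c j k.
  apply/matrixP => i j; have := congr1 (fun x : 'cV_d.+1 => x i 0) (Hc j).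
  rewrite colE mulmxA -colE mxE => ->; rewrite summxE mxE; apply: eq_bigr => k _.
  by rewrite -col_step_matrix -scaler_int !mxE intz mulrC.
split; first exact: E.
  rewrite unitmxE; have := congr1 determinant E; rewrite !det_mulmx mulrC.
  by move=> /(mulfI det_step_matrix) <-; rewrite -unitmxE.
move=> z /eigenvalueP[v vE v0]; apply: hypA.
set M := map_mx intr step_matrix : 'M[R[i]]_d.+1.
have uM : M \in unitmx.
  by rewrite unitmxE det_map_mx unitfE intr_eq0 det_step_matrix.
apply/eigenvalueP; exists (v *m invmx M); last first.
  apply: contra v0 => /eqP h; rewrite -[v](mulmxKV uM) h mul0mx //.
have EC : map_mx intr A *m M = M *m map_mx intr (\matrix_(k, j) c j k).
  by rewrite -!map_mxM E.
rewrite -[map_mx intr A](mulmxK uM) EC !mulmxA mulmxKV // vE.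
by rewrite scalemxAl.
Qed.

(** One step more than the generators require, because a digit involves both eta and
    eta A'. *)
Lemma digit_decay (A' : 'M[int]_d.+1) : A *m step_matrix = step_matrix *m A' ->
  exists J (rho : R), 0 <= rho < 1 /\ forall n (xi : 'rV[int]_d.+1), (0 < n)%N ->
    (forall j, (j < J)%N -> rho < normc (fourier (@step_pmf R n d.+1 mu) (xi *m A ^+ j))) ->
    digit A' n (xi *m step_matrix) = 0.
Proof.
move=> EA.
pose W := (2 * entry_mass A')%N.
have W0 : (0 : R) < W%:R^-1 by rewrite invr_gt0 ltr0n /W muln_gt0.
have C (j : 'I_d.+1) := controlled_step_subgroup (step_matrix_in j).
have [J HJ] := boolp.choice C.
have D (j : 'I_d.+1) : exists rho : R, 0 <= rho < 1 /\
  forall (n : nat) (xi : 'rV[int]_d.+1), (0 < n)%N ->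
    (forall i, (i < J j)%N -> rho < normc (fourier (@step_pmf R n d.+1 mu) (xi *m A ^+ i))) ->
    exists m, W%:Z * `|(xi *m step_matrix) 0 j - n%:Z * m| <= n%:Z.
  have [r r01 Hr] := HJ j _ W0; exists r; split => // n xi n0 h.
  have [m] := Hr n xi n0 h.
  rewrite ler_pdivlMl; last by rewrite -invr_gt0.
  rewrite -[W%:R]/(W%:Z%:~R) -intrM -[n%:R]/(n%:Z%:~R) ler_int => hm; exists m.
  by move: hm; rewrite colE mulmxA -colE mxE.
have [rho Hrho] := boolp.choice D.
exists (\max_j J j).+1, (\big[Num.max/0]_j rho j); split.
  rewrite bigmax_ge_id /=; apply: bigmax_lt => // j _.
  by have [/andP[]] := Hrho j.
move=> n xi n0 H.
have key (xi' : 'rV[int]_d.+1) : (forall i, (i < \max_j J j)%N ->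
   \big[Num.max/0]_j rho j < normc (fourier (@step_pmf R n d.+1 mu) (xi' *m A ^+ i))) ->
   forall j, exists m, W%:Z * `|(xi' *m step_matrix) 0 j - n%:Z * m| <= n%:Z.
  move=> h j; apply: (Hrho j).2 => // i ij; apply: le_lt_trans (h i _).
    exact: (le_bigmax _ (fun j => rho j) j).
  exact: leq_trans ij (leq_bigmax _).
apply: digit_eq0 => //.
  by apply: key => i ij; apply: H; apply: ltnW.
rewrite -mulmxA -EA mulmxA; apply: key => i ij.
by rewrite -mulmxA mulmxE -exprS; apply: H.
Qed.

End Lattice.

(** * The mixing bound *)

(** If q xi = n c then c / q determines xi / n, and both q and the entries of c are below Q. *)
Lemma count_small_denominators (m d Q : nat) :
  (#|[set xi : {ffun 'I_d -> 'I_m.+1} |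
      [exists q : 'I_Q, (0 < q) && [forall j, m.+1 %| q * xi j]]]%SET| <= Q ^ d.+1)%N.
Proof.
pose g (p : 'I_Q * {ffun 'I_d -> 'I_Q}) : {ffun 'I_d -> 'I_m.+1} :=
  [ffun j => inord (p.2 j * m.+1 %/ p.1)].
apply: (@leq_trans #|g @: [set: 'I_Q * {ffun 'I_d -> 'I_Q}]%SET|); last first.
  apply: leq_trans (leq_imset_card _ _) _.
  by rewrite cardsT card_prod card_ffun !card_ord expnS.
apply/subset_leq_card/fintype.subsetP => xi; rewrite inE => /existsP[q /andP[q0 /forallP H]].
apply/imsetP; exists (q, [ffun j => insubd q (q * xi j %/ m.+1)%N]) => //.
apply/ffunP => j; rewrite !ffunE /=; apply: val_inj.
have Ec : insubd q (q * xi j %/ m.+1)%N = (q * xi j %/ m.+1)%N :> nat.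
  rewrite val_insubd ifT //; apply: leq_ltn_trans _ (ltn_ord q).
  rewrite -ltnS ltn_divLR // mulSn.
  have := ltn_ord (xi j); clear -q0; nia.
by rewrite Ec divnK // mulKn //= inordK.
Qed.

(** From 2^k >= (m + 1)^3 with m the integer part of k / 3. *)
Lemma exp2_dominates_square c k : (27 * c <= k)%N -> (c * k ^ 2 <= 2 ^ k)%N.
Proof.
move=> hk; pose m := (k %/ 3)%N.
have h1 : (m.+1 ^ 3 <= 2 ^ k)%N.
  apply: (@leq_trans ((2 ^ m) ^ 3)); first by rewrite leq_exp2r // ltn_expl.
  by rewrite -expnM leq_exp2l // leq_trunc_div.
apply: leq_trans h1.
have h2 : (k < 3 * m.+1)%N by rewrite mulnC; apply: ltn_ceil.
have h3 : (9 * c <= m.+1)%N by clear -h2 hk; lia.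
have h4 : (k ^ 2 <= 9 * m.+1 ^ 2)%N by rewrite -[9%N]/(3 ^ 2)%N -expnMn leq_exp2r // ltnW.
rewrite expnS; apply: leq_trans (leq_mul (leqnn c) h4) _.
by rewrite mulnA; apply: leq_mul => //; rewrite mulnC.
Qed.

Section Decay.
Variables (R : realType) (psi : nat -> R) (nz : nat -> bool) (J : nat) (rho : R).
Hypothesis psi01 : forall s, 0 <= psi s <= 1.
Hypothesis nz_far : forall s, nz s -> exists2 j, (j < J)%N & psi (s + j)%N <= rho.

(** Each nonzero digit is charged to a factor at most rho among the next J ones, so such a
    factor is charged at most J times; J + 1 is a positive version of this constant. *)
Lemma product_decay t : exists2 F,
  (\sum_(s < t - J) nz s <= J.+1 * F)%N & \prod_(s < t) psi s <= rho ^+ F.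
Proof.
pose far s := psi s <= rho.
exists (\sum_(s < t) far s)%N; last first.
  rewrite -prodrXr; apply: ler_prod => s _.
  have /andP[p0 p1] := psi01 s; rewrite p0 /=.
  by case hf : (far s); rewrite ?expr1 ?expr0.
apply: (@leq_trans (\sum_(s < t - J) \sum_(j < J) far (s + j))%N).
  apply: leq_sum => s _; case hs : (nz s) => //.
  have [j jJ hj] := nz_far hs.
  by rewrite (bigD1 (Ordinal jJ)) //= /far hj.
rewrite exchange_big /=.
apply: (@leq_trans (\sum_(j < J) \sum_(s < t) far s)%N); last first.
  by rewrite sum_nat_const card_ord leq_mul2r leqnSn orbT.
apply: leq_sum => j _.
rewrite -(big_mkord xpredT (fun s => nat_of_bool (far (s + j)%N))).
rewrite -(big_mkord xpredT (fun s => nat_of_bool (far s))).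
have [h|h] := leqP t J.
  by move/eqP: (h) => ->; rewrite big_geq.
rewrite (@big_cat_nat _ _ _ j 0 t) //=; last first.
  by apply: ltnW; apply: leq_trans (ltn_ord j) _; exact: ltnW.
apply: leq_trans (leq_addl _ _).
have hj : (t - J <= t - j)%N by apply: leq_sub2l; apply: ltnW.
rewrite -{2}[j : nat]add0n big_addn.
by rewrite (@big_cat_nat _ _ _ (t - J) 0 (t - j)) //= leq_addr.
Qed.

End Decay.

Section Mixing.
Variables (R : realType) (d : nat) (A : 'M[int]_d.+1) (mu : probability 'cV[int]_d.+1 R).
Variables (u : 'I_d.+1 -> 'cV[int]_d.+1) (hu : Z_basis u).
Variables (a : 'I_d.+1 -> nat) (ha : forall i, (0 < a i)%N).
Hypothesis hgen : step_subgroup mu A = generated (range (fun i => u i *+ a i)).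
Variables (dO : measure_display) (O : measurableType dO) (P : probability O R).
Variables (B : nat -> {RV P >-> 'cV[int]_d.+1}).
Hypothesis hB : iid (fun t => B t.+1) mu.
Variables (A' : 'M[int]_d.+1) (L D J : nat) (rho : R).
Local Notation H := (step_matrix u a).
Hypothesis EA : A *m H = H *m A'.
Hypothesis uA' : A' \in unitmx.
Hypothesis HL : vanishing A' L.
Hypothesis L0 : (0 < L)%N.
Hypothesis D0 : (0 < D)%N.
Hypothesis rho01 : 0 <= rho < 1.
Hypothesis Hdecay : forall n (xi : 'rV[int]_d.+1), (0 < n)%N ->
    (forall j, (j < J)%N -> rho < normc (fourier (@step_pmf R n d.+1 mu) (xi *m A ^+ j))) ->
    digit A' n (xi *m H) = 0.

Local Notation law n t := (law_pmf P (fun w => walk n A (fun s => B s w) t)).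

Lemma intertwine s : A ^+ s *m H = H *m A' ^+ s.
Proof.
elim: s => [|s IH]; first by rewrite !expr0 mulmx1 mul1mx.
rewrite !exprS -[A * A ^+ s]/(A *m A ^+ s) -[A' * A' ^+ s]/(A' *m A' ^+ s).
by rewrite -mulmxA IH !mulmxA EA.
Qed.

Lemma fourier_step_le1 n (xi : 'rV[int]_d.+1) : (0 < n)%N ->
  normc (fourier (@step_pmf R n d.+1 mu) xi) <= 1.
Proof.
move=> n0; rewrite -(sum_step_pmf n mu); apply: le_trans (normc_sum _ _) _.
apply: ler_sum => z _.
by rewrite ComplexField.Normc.normcM normc_unit_exp mulr1 normc_real ger0_norm // step_pmf_ge0.
Qed.

Lemma fourier_law_decay n t (xi : 'rV[int]_d.+1) : (0 < n)%N -> exists2 F,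
  (nonzero_digits A' n (xi *m H) (t - J) <= J.+1 * F)%N &
  normc (fourier (law n t) xi) <= rho ^+ F.
Proof.
move=> n0; rewrite (fourier_walk A n0 hB) normc_prod.
apply: (@product_decay R (fun s => normc (fourier (@step_pmf R n d.+1 mu) (xi *m A ^+ s)))
  (fun s => digit A' n (xi *m H *m A' ^+ s) != 0) J rho _ _ t).
  by move=> s; rewrite normc_ge0 fourier_step_le1.
move=> s; apply: contraPP => hn; apply/negP; rewrite negbK.
rewrite -mulmxA -intertwine mulmxA; apply/eqP/Hdecay => // j jJ.
rewrite ltNge; apply/negP => h; apply: hn; exists j => //.
by rewrite exprD -[A ^+ s * _]/(A ^+ s *m A ^+ j) mulmxA.
Qed.

(** Reduce eta / n to lowest terms, with denominator q.  If q has high level, it is not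
    exceptional as a divisor of n, and every window has many nonzero digits; otherwise
    there is still at least one in every window, which is shorter. *)
Lemma nonzero_digits_lower n (xi : 'rV[int]_d.+1) t :
  avoiding (coprime_to_all a) (exceptional A' L D) n ->
  ~ (exists w, xi = n%:Z *: w) ->
  (t <= 4 * L * D * nonzero_digits A' n (xi *m H) t + 4 * L * (trunc_log 2 n).+1)%N \/
  (t %/ (4 * L * level_bound n) <= nonzero_digits A' n (xi *m H) t)%N /\
  (exists q : nat, [/\ (0 < q)%N, (q < 2 ^ level_bound n)%N & exists w, q%:Z *: xi = n%:Z *: w]).
Proof.
move=> [cop avoid] nxi; have n0 := cop.1.
have [g [q [w [Enq Ew pw]]]] := primitive_reduction (xi *m H) n0.
have [g0 q0] : (0 < g)%N /\ (0 < q)%N by apply/andP; rewrite -muln_gt0 -Enq.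
have qn : (q %| n)%N by rewrite Enq dvdn_mull.
have -> : nonzero_digits A' n (xi *m H) t = nonzero_digits A' q w t.
  by rewrite Ew Enq nonzero_digits_scale.
set k := trunc_log 2 q; set K := k.+1; pose T := (L * K.*2).*2.
have ET : T = (4 * L * K)%N by rewrite /T; clear; lia.
have T0 : (0 < T)%N by rewrite ET !muln_gt0 L0.
have qK : (q < 2 ^ K)%N by have /andP[] := @trunc_log_bounds 2 q isT q0.
have [hk|hk] := leqP (level_bound n) k.
  (* Each window of length T = 4 L K holds more than K / D nonzero digits, so their
     density is at least 1 / (4 L D), whatever K. *)
  left; have hw s : (K %/ D < nonzero_digits A' q (w *m A' ^+ s) T)%N.
    rewrite ltnNge; apply/negP => h.
    have : (k < level_bound n)%N.
      by apply: avoid => //; exists (w *m A' ^+ s); split => //; apply: primitive_orbit.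
    by rewrite ltnNge hk.
  have := nonzero_digits_windows t hw.
  have h1 : (K <= (K %/ D).+1 * D)%N by apply/ltnW/ltn_ceil.
  have h2 : (t <= t %/ T * T + T)%N by rewrite addnC -mulSn; apply/ltnW/ltn_ceil.
  have h3 : (K <= (trunc_log 2 n).+1)%N by rewrite ltnS leq_trunc_log // dvdn_leq.
  move=> h4.
  apply: leq_trans h2 _; apply: leq_add; last by rewrite ET leq_mul2l h3 orbT.
  rewrite {2}ET mulnCA -[leqRHS]mulnA leq_mul2l; apply/orP; right.
  apply: leq_trans (_ : t %/ T * ((K %/ D).+1 * D) <= _)%N; first by rewrite leq_mul2l h1 orbT.
  by rewrite mulnA mulnC leq_mul2l h4 orbT.
right; split; last first.
  exists q; split => //; first by apply: leq_trans qK _; rewrite leq_exp2l.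
  apply: (coprime_divides hu cop); exists w.
  by rewrite -scalemxAl Ew scalerA -PoszM mulnC -Enq.
have hw s : (0 < nonzero_digits A' q (w *m A' ^+ s) T)%N.
  apply: exists_nonzero_digit => //.
    by rewrite q0 (leq_trans qK) // leq_exp2l // -addnn leq_addr.
  move=> [v Ev]; apply: nxi; apply: (coprime_divides hu cop).
  exists (v *m invmx (A' ^+ s)).
  rewrite Ew Enq PoszM -scalerA; congr (_ *: _).
  by rewrite scalemxAl -Ev mulmxK // unitrX.
have := nonzero_digits_windows t hw; rewrite muln1; apply: leq_trans.
by apply: leq_div2l => //; rewrite ET leq_mul2l hk orbT.
Qed.

Lemma int_row_not_multiple n (xi : {ffun 'I_d.+1 -> 'I_n.-1.+1}) : (0 < n)%N ->
  int_row xi != 0 -> ~ (exists w, int_row xi = n%:Z *: w).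
Proof.
move=> n0 /eqP xi0 [w E]; apply: xi0; apply/rowP => j.
have := congr1 (fun v : 'rV_d.+1 => v 0 j) E; rewrite !mxE => Ej.
have : (n %| xi j)%N by have : (n%:Z %| (xi j : nat)%:Z)%Z by rewrite Ej dvdz_mulr.
have xn : (xi j < n)%N by rewrite -[X in (_ < X)%N](prednK n0).
by rewrite /dvdn modn_small // => /eqP ->.
Qed.

Variable E : nat.
Hypothesis HE : rho ^+ E <= 2 ^- (d + 3).

Lemma power_decay F k : (E * k <= F)%N -> rho ^+ F <= 2 ^- ((d + 3) * k).
Proof.
move=> h; have /andP[r0 r1] := rho01.
apply: le_trans (_ : rho ^+ (E * k) <= _); first by rewrite ler_wiXn2l // ltW.
rewrite !exprM -exprVn; apply: lerXn2r => //; rewrite nnegrE ?exprn_ge0 //.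
Qed.

(** Frequencies of high level contribute at most n^(d+1) 2^(-(d+3)(l+1)) with l the
    integer part of log_2 n, and the others at most 2^(k (d+2)) 2^(-(d+3) k) with
    k = level_bound n; here the dimension is d + 1, and E is such that E factors rho give
    2^(-(d+3)). *)
Lemma mixing_bound n t :
  avoiding (coprime_to_all a) (exceptional A' L D) n ->
  (0 < level_bound n)%N -> (27 * (J.+1 * E) <= level_bound n)%N ->
  ((J + 8 * L + 8 * L * D * (J.+1 * E)) * trunc_log 2 n < t)%N ->
  tv (law n t) (@uniform_pmf R (torus n d.+1)) <= 2 / 2 ^+ level_bound n.
Proof.
move=> Gn k0 k27 ht; have n0 := Gn.1.1.
apply: le_trans (tv_fourier n0 (sum_law_walk A n0 hB t)) _.
set l := trunc_log 2 n in ht; set k := level_bound n in k0 k27 *.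
have l0 : (0 < l)%N by move: k0; rewrite /k /level_bound -/l; case: (l).
have kl : (2 ^ k <= l)%N by rewrite /k /level_bound -/l trunc_logP.
have kl' : (k <= l)%N by apply: leq_trans kl; apply/ltnW/ltn_expl.
pose S := [set xi : {ffun 'I_d.+1 -> 'I_n.-1.+1} |
      [exists q : 'I_(2 ^ k), (0 < q)%N && [forall j, (n.-1.+1 %| q * xi j)%N]]]%SET.
pose x : R := 2 ^- ((d + 3) * l.+1); pose y : R := 2 ^- ((d + 3) * k).
have x0 : 0 <= x by rewrite invr_ge0 exprn_ge0.
have y0 : 0 <= y by rewrite invr_ge0 exprn_ge0.
have key (xi : {ffun 'I_d.+1 -> 'I_n.-1.+1}) : int_row xi != 0 ->
    normc (fourier (law n t) (int_row xi)) <= x + (if xi \in S then y else 0).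
  move=> xi0; have [F HF HF'] := fourier_law_decay t (int_row xi) n0.
  apply: le_trans HF' _.
  have [hl|[hs [q [q0 qk [w Ew]]]]] :=
    nonzero_digits_lower (t - J) Gn (int_row_not_multiple n0 xi0).
    apply: le_trans (_ : x <= _); last by case: ifP; rewrite ?addr0 ?lerDl.
    apply: power_decay; rewrite leqNgt; apply/negP => hF.
    have h1 : (4 * L * D * nonzero_digits A' n (int_row xi *m H) (t - J) <=
       4 * L * D * (J.+1 * E) * l.+1)%N.
      have -> : (4 * L * D * (J.+1 * E) * l.+1 = 4 * L * D * (J.+1 * (E * l.+1)))%N.
        by rewrite !mulnA.
      rewrite leq_mul2l; apply/orP; right; apply: leq_trans HF _.
      by rewrite leq_mul2l ltnW // orbT.
    rewrite -/l in hl.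
    have {hl h1} h2 : (t - J <= 4 * L * D * (J.+1 * E) * l.+1 + 4 * L * l.+1)%N.
      by apply: leq_trans hl _; rewrite leq_add2r.
    have E1 : (8 * L * D * (J.+1 * E) = 2 * (4 * L * D * (J.+1 * E)))%N by rewrite !mulnA.
    rewrite E1 in ht; move: ht h2 l0; move: (4 * L * D * (J.+1 * E))%N => X; clear.
    nia.
  have xiS : xi \in S.
    rewrite inE; apply/existsP; exists (Ordinal qk); rewrite q0 /=; apply/forallP => j.
    rewrite [X in (X %| _)%N](prednK n0).
    have := congr1 (fun v : 'rV_d.+1 => v 0 j) Ew; rewrite !mxE -PoszM => Ej.
    by have : (n%:Z %| (q * xi j)%N%:Z)%Z by rewrite Ej dvdz_mulr.
  rewrite xiS; apply: le_trans (_ : y <= _); last by rewrite lerDr.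
  apply: power_decay.
  have h1 : (4 * L * l <= t - J)%N by move: ht l0; clear; nia.
  have h2 : (l %/ k <= J.+1 * F)%N.
    apply: leq_trans HF; apply: leq_trans hs.
    have -> : (l %/ k = 4 * L * l %/ (4 * L * k))%N by rewrite divnMl // muln_gt0.
    exact: leq_div2r.
  have h3 : (J.+1 * E * k <= l %/ k)%N.
    rewrite leq_divRL // -mulnA mulnn.
    by apply: leq_trans kl; apply: exp2_dominates_square.
  by rewrite -(leq_pmul2l (ltn0Sn J)) mulnA (leq_trans h3).
apply: le_trans (_ : \sum_(xi : {ffun 'I_d.+1 -> 'I_n.-1.+1})
    (x + (if xi \in S then y else 0)) <= _).
  rewrite [leRHS](bigID (fun xi => int_row xi != 0)) /=.
  apply: ler_wpDr; last by apply: ler_sum.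
  by apply: sumr_ge0 => xi _; apply: addr_ge0 => //; case: ifP.
rewrite big_split /= sumr_const -big_mkcond /= sumr_const.
have n2 : (n <= 2 ^ l.+1)%N by have /andP[_ /ltnW] := @trunc_log_bounds 2 n isT n0.
have c1 : (#|{: {ffun 'I_d.+1 -> 'I_n.-1.+1}}|%:R : R) <= 2 ^+ (l.+1 * d.+1).
  rewrite card_ffun !card_ord prednK // -natrX ler_nat expnM.
  exact: leq_expl.
have c2 : (#|S|%:R : R) <= 2 ^+ (k * d.+2).
  by rewrite -natrX ler_nat expnM; apply: count_small_denominators.
have p0 m : (0 : R) < 2 ^+ m by rewrite exprn_gt0.
have pw (m r : nat) : (r <= m)%N -> (2 ^+ m)^-1 * 2 ^+ r = (2 ^+ (m - r))^-1 :> R.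
  move=> rm; rewrite -{1}(subnK rm) exprD invfM -mulrA mulVf ?mulr1 //.
have b1 : x *+ #|{: {ffun 'I_d.+1 -> 'I_n.-1.+1}}| <= (2 ^+ k)^-1.
  rewrite -(mulr_natr x); apply: le_trans (_ : x * 2 ^+ (l.+1 * d.+1) <= _).
    by rewrite ler_wpM2l.
  rewrite /x pw; last by rewrite mulnC leq_mul // addnS ltnS leq_addr.
  rewrite lef_pV2 ?posrE // ler_eXn2l ?ltr1n //.
  by move: kl'; clear; nia.
have b2 : y *+ #|S| <= (2 ^+ k)^-1.
  rewrite -(mulr_natr y); apply: le_trans (_ : y * 2 ^+ (k * d.+2) <= _).
    by rewrite ler_wpM2l.
  rewrite /y pw; last by rewrite mulnC leq_mul // addn3 ltnS.
  rewrite lef_pV2 ?posrE // ler_eXn2l ?ltr1n //.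
  by clear; nia.
lra.
Qed.

End Mixing.

Local Close Scope complex_scope.

Lemma trunc_log_le_ln (R : realType) n : (0 < n)%N -> (trunc_log 2 n)%:R * ln 2 <= ln n%:R :> R.
Proof.
move=> n0; rewrite mulr_natl -lnXn // ler_ln ?posrE ?exprn_gt0 ?ltr0n //.
by rewrite -natrX ler_nat trunc_logP.
Qed.

Lemma ereal_sup_bounds (R : realType) (T : Type) (S : set T) (f : T -> R) (b : R) :
  S !=set0 -> (forall t, S t -> 0 <= f t <= b) ->
  (0 <= ereal_sup [set (f t)%:E | t in S] <= b%:E)%E.
Proof.
move=> [t0 St0] H; apply/andP; split.
  apply: (@le_trans _ _ (f t0)%:E); first by rewrite lee_fin; have /andP[] := H t0 St0.
  by apply: ereal_sup_ubound; exists t0.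
by apply: ge_ereal_sup => _ [t St <-]; rewrite lee_fin; have /andP[] := H t St.
Qed.

Unset Implicit Arguments.

Theorem theorem3 (R : realType) (d : nat) (hd : (2 <= d)%N)
    (mu : probability 'cV[int]_d R)
    (A : 'M[int]_d) (hA : A \in unitmx) (hhyp : hyperbolic R A)
    (dO : measure_display) (O : measurableType dO) (P : probability O R)
    (B : nat -> {RV P >-> 'cV[int]_d}) (hB : iid (fun t => B t.+1) mu)
    (u : 'I_d -> 'cV[int]_d) (hu : Z_basis u)
    (a : 'I_d -> nat) (ha : forall i, (0 < a i)%N)
    (hrank : has_rank (step_subgroup mu A) d)
    (hgen : step_subgroup mu A = generated (range (fun i => u i *+ a i))) :
  exists (C : R) (G : set nat),
    [/\ 0 < C,
        G `<=` coprime_to_all a,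
        (count_upto G N)%:R / (count_upto (coprime_to_all a) N)%:R
          @[N --> \oo] --> (1 : R)
      & ereal_sup [set (tv (law_pmf P (fun w => walk n A (fun s => B s w) t))
                           (@uniform_pmf R (torus n d)))%:E
                  | t in [set t : nat | C * ln n%:R < t%:R]]
          @[n --> within G \oo] --> 0%E].
Proof.
case: d hd mu A hA hhyp B hB u hu a ha hrank hgen => [//|d] _ mu A hA hhyp B hB u hu a ha _ hgen.
have [A' [EA uA' hypA']] := conjugate_matrix hu ha hgen hA hhyp.
have [L L0 HL] := hyperbolic_vanish hypA'.
have [D D0 Hcount] := count_exceptional HL uA' L0.
have [J [rho [rho01 Hdecay]]] := digit_decay hgen EA.
have [E HE] : exists E, rho ^+ E <= 2 ^- (d + 3).
  by have /andP[r0 r1] := rho01; apply: exp_lt_eps; rewrite ?invr_gt0 ?exprn_gt0.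
pose M := (J + 8 * L + 8 * L * D * (J.+1 * E))%N.
have ln2 : 0 < ln 2 :> R by rewrite ln_gt0 // ltr1n.
have M0 : (0 < M)%N by rewrite /M; move: L0; clear; lia.
(* [mixing_bound] measures n by its logarithm in base 2. *)
exists (M%:R / ln 2), (avoiding (coprime_to_all a) (exceptional A' L D)); split.
- by rewrite divr_gt0 // ltr0n.
- by move=> n [].
- exact: avoiding_density.
pose b n : R := 2 / 2 ^+ level_bound n.
have b0 : (b n)%:E @[n --> within (avoiding (coprime_to_all a) (exceptional A' L D)) \oo] --> 0%E.
  apply/fine_cvgP; split; first by near=> n.
  apply: cvg_within_filter; apply/cvgrPdist_le => eps e0.
  have [j Hj] : exists j, (2^-1) ^+ j <= eps / 2 :> R.
    by apply: exp_lt_eps; lra.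
  near=> n; rewrite sub0r normrN /= ger0_norm; last by rewrite divr_ge0 // exprn_ge0.
  rewrite /b -exprVn mulrC -ler_pdivlMr //; apply: le_trans Hj.
  rewrite ler_wiXn2l ?invr_ge0 ?invf_le1 ?ler1n //.
  by apply: level_bound_ge; near: n; apply: nbhs_infty_ge.
apply: (squeeze_cvge _ (cvg_cst 0%E) b0).
near=> n.
have Gn : avoiding (coprime_to_all a) (exceptional A' L D) n.
  by near: n; apply: withinT.
have n0 := Gn.1.1.
have hk : ((27 * (J.+1 * E)).+1 <= level_bound n)%N.
  apply: level_bound_ge; near: n; apply: cvg_within; apply: nbhs_infty_ge.
apply: ereal_sup_bounds.
  exists (Num.truncn (M%:R / ln 2 * ln (n%:R : R))).+1; rewrite /=.
  exact: truncnS_gt.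
move=> t /= ht; apply/andP; split.
  by rewrite mulr_ge0 ?invr_ge0 // sumr_ge0.
apply: (mixing_bound hu hB EA uA' HL L0 D0 rho01 Hdecay HE) => //.
- exact: leq_ltn_trans hk.
- exact: ltnW.
rewrite -(ltr_nat R) natrM; apply: le_lt_trans ht.
rewrite -mulrA ler_wpM2l // mulrC ler_pdivlMr //.
exact: trunc_log_le_ln.
Unshelve. all: by end_near.
Qed.
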